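(* Let $\mathcal{H}$ be a separable complex Hilbert space, let $A, B \in L(\mathcal{H})$ have closed range, let $C \in L(\mathcal{H})$ and let $W \in L(\mathcal{H})^{+}$ be such that $W^{1/2} \in S_p$ for some $p$ with $1 \leq p < \infty$. If $$N(B) \subseteq N(A^*WC) \quad\mbox{and}\quad R(C) \subseteq R(A) + R(A)^{\perp_{W}},$$ then there exists $X_0 \in L(\mathcal{H})$ such that $$\min_{X \in L(\mathcal{H})} \Vert AXB-C \Vert_{p,W}=\Vert AX_0B-C \Vert_{p,W}=\Vert W_{/R(A)}^{1/2}C \Vert_{p}.$$
   Context: $L(\mathcal{H})$ is the algebra of bounded linear operators on $\mathcal{H}$ and $L(\mathcal{H})^{+}$ is the cone of positive semidefinite operators. $R(T)$ and $N(T)$ denote the range and the nullspace of $T$. Order: $S\le T$ if $T-S\in L(\mathcal{H})^{+}$. For $1\le p<\infty$, $S_p$ is the $p$-Schatten class of compact operators $T$ on $\mathcal{H}$ with $\sum_k\lambda_k(T)^p<\infty$, where $\lambda_k(T)$ are the eigenvalues of $|T|=(T^*T)^{1/2}$ repeated according to multiplicity, and $\Vert T\Vert_p=(\sum_k\lambda_k(T)^p)^{1/p}$. When $W^{1/2}\in S_p$, $\Vert X\Vert_{p,W}=\Vert W^{1/2}X\Vert_p$ for $X\in L(\mathcal{H})$. For $\mathcal{S}\subseteq\mathcal{H}$, $\mathcal{S}^{\perp_W}=\{x\in\mathcal{H}:\langle Wx,y\rangle=0 \text{ for all } y\in \mathcal{S}\}=W^{-1}(\mathcal{S}^\perp)$.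 For a closed subspace $\mathcal{S}$, the shorted operator of $W$ to $\mathcal{S}$ is $W_{/\mathcal{S}}=\max \{ X \in L(\mathcal{H}): 0\leq X\leq W \mbox{ and } R(X)\subseteq \mathcal{S}^{\perp}\}$ (it is known that this maximum always exists), and $W_{/\mathcal{S}}^{1/2}=(W_{/\mathcal{S}})^{1/2}$. *)

(* Defs.v *)
From HB Require Import structures.
From mathcomp Require Import all_boot all_order all_algebra.
From mathcomp Require Import complex sesquilinear.
From mathcomp Require Import all_classical all_reals all_analysis.
Import Order.TTheory GRing.Theory Num.Theory.
Import numFieldNormedType.Exports.

Set Implicit Arguments.
Unset Strict Implicit.
Unset Printing Implicit Defensive.

Local Open Scope classical_set_scope.
Local Open Scope complex_scope.
Local Open Scope ring_scope.

(* The inner product is linear in its first argument and conjugate-linear in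
   its second one. *)
HB.mixin Record CompleteNormedModule_isHilbert (R : realType) H
    of CompleteNormedModule R[i] H := {
  inner : {dot H for (@Num.conj R[i])} ;
  inner_norm : forall x : H, inner x x = `|x| ^+ 2
}.

#[short(type="hilbertType")]
HB.structure Definition Hilbert (R : realType) :=
  {H of CompleteNormedModule R[i] H & CompleteNormedModule_isHilbert R H}.

Definition separable (T : topologicalType) :=
  exists2 D : set T, countable D & dense D.

Section operators.
Context {R : realType} {H : hilbertType R}.
Implicit Types (S T W X : H -> H) (M : set H).

Definition bounded_op T :=
  linear T /\ exists c : R[i], forall x, `|T x| <= c * `|x|.

Definition nullspace T : set H := [set x | T x = 0].

(* In R[i], 0 <= z also says that z is real. *)
Definition psd T := bounded_op T /\ forall x, 0 <= inner (T x) x.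

Definition op_le S T := psd (T \- S).

(* Operators characterized by a property are selected by choice, the zero
   operator being the value when nothing satisfies the property. *)
Definition adjoint T : H -> H :=
  xget (fun=> 0) [set S | bounded_op S /\
                          forall x y, inner (T x) y = inner x (S y)].

Definition sqrt_op T : H -> H :=
  xget (fun=> 0) [set S | psd S /\ S \o S = T].

Definition abs_op T : H -> H := sqrt_op (adjoint T \o T).

Definition orthc M : set H := [set x | forall y, M y -> inner x y = 0].

Definition weighted_orthc W M : set H :=
  [set x | forall y, M y -> inner (W x) y = 0].

Definition shortable W M : set (H -> H) :=
  [set X | [/\ bounded_op X, op_le (fun=> 0) X, op_le X W &
               range X `<=` orthc M]].

Definition shorted W M : H -> H :=
  xget (fun=> 0) [set X | shortable W M X /\
                          forall Y, shortable W M Y -> op_le Y X].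

Definition compact_op T := compact (closure (T @` [set x | `|x| <= 1])).

Definition lin_indep n (e : 'I_n -> H) :=
  forall c : 'I_n -> R[i], \sum_(i < n) c i *: e i = 0 -> forall i, c i = 0.

Definition dimension M : \bar R :=
  ereal_sup [set n%:R%:E | n in [set n | exists e : 'I_n -> H,
                                   lin_indep e /\ forall i, M (e i)]].

Definition eigenspace T (l : R) : set H := [set x | T x = l%:C *: x].

(* Real eigenvalues only: these are all the eigenvalues of an operator |T|. *)
Definition eigenvalues T : set R :=
  [set l | exists2 x, x != 0 & eigenspace T l x].

(* The sum of the p-th powers of the eigenvalues of |T|, each of them being
   counted as many times as the dimension of its eigenspace. *)
Definition schatten_sum (p : R) T : \bar R :=
  (\esum_(l in eigenvalues (abs_op T))
     (dimension (eigenspace (abs_op T) l) * (l `^ p)%:E))%E.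

Definition schatten_class (p : R) T :=
  [/\ bounded_op T, compact_op T & (schatten_sum p T < +oo)%E].

Definition schatten_norm (p : R) T : \bar R := (schatten_sum p T `^ p^-1)%E.

Definition weighted_norm (p : R) W X : \bar R :=
  schatten_norm p (sqrt_op W \o X).

End operators.

(* Main.v *)
(** With S = W^{1/2} and G = S A, the hypothesis on R(C) says that the
    projection K x of S C x on the closure of R(G) lies in R(G). By Douglas'
    lemma K = G X1 for some bounded X1 with range in the orthogonal complement of
    N(G); it vanishes on N(B) because K does, and composing it with a bounded
    right inverse of B on R(B) gives X0 with X1 = X0 B. Writing
    C x = A u + v with v in R(A)^{perp_W}, one gets S (A X0 B - C) x = - S v,
    which is orthogonal to R(G): hence by Pythagoras |S (A X0 B - C) x| is at
    most |S (A X B - C) x| for every X, and it equals |W_/^{1/2} C x|, where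
    W_/ = S P S with P the projection on the orthogonal complement of S R(A).
    Pointwise domination |T1 x| <= |T2 x| passes to the Schatten norms because
    an orthonormal family of eigenvectors of |T1| can be matched, in decreasing
    order of eigenvalues, with one of |T2| having larger eigenvalues. *)
Require Import Defs.
From mathcomp Require Import all_boot all_order all_algebra.
From mathcomp Require Import complex sesquilinear.
From mathcomp Require Import all_classical all_reals all_analysis.
From mathcomp Require Import ring lra.
Import Order.TTheory GRing.Theory Num.Theory.
Import numFieldNormedType.Exports.

Set Implicit Arguments.
Unset Strict Implicit.
Unset Printing Implicit Defensive.

Local Open Scope classical_set_scope.
Local Open Scope complex_scope.
Local Open Scope ring_scope.

(** * Norm and inner product *)

Section Hilbert_norm.
Context {R : realType}.
Implicit Types a : R[i].

(** The vector u in C x = A u + v depends on x without any linearity or bound; only G u, the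
    projection of S C x, is determined, and Douglas' lemma turns this pointwise solvability into a
    bounded operator. The inclusion of N(B) in N(A^* W C) enters through |G u|^2 = <W C x, A u> =
    <A^* W C x, u>, which is zero when B x = 0. Competitors are compared vector by vector, so the
    Schatten norm has to be shown monotone from its definition as a sum over eigenvalues with
    multiplicity. The obstacle is to produce eigenvectors of |T2| from those of |T1|. Compactness of
    W^{1/2}, inherited by T2 = S (A X B - C), gives |T2| an eigenvector in every closed invariant
    subspace on which T2 does not vanish; so they are obtained one at a time, orthogonally to those
    already found. Finite families are enough, the sums being suprema over finite sets. *)

Definition cnorm a : R := complex.Re `|a|.

Lemma cnormE a : `|a| = (cnorm a)%:C.
Proof. by rewrite /cnorm RRe_real// normr_real. Qed.

Lemma cnorm_ge0 a : 0 <= cnorm a.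
Proof. by rewrite -ler0c -cnormE. Qed.

Lemma cnormM a b : cnorm (a * b) = cnorm a * cnorm b.
Proof. by apply: complexI; rewrite rmorphM/= -!cnormE normrM. Qed.

Lemma cnormV a : cnorm a^-1 = (cnorm a)^-1.
Proof. by apply: complexI; rewrite fmorphV/= -!cnormE normfV. Qed.

Lemma cnorm_real (r : R) : cnorm r%:C = `|r|.
Proof. by apply: complexI;
  rewrite -cnormE normc_def/= expr0n/= addr0 sqrtr_sqr. Qed.

Lemma cnormD a b : cnorm (a + b) <= cnorm a + cnorm b.
Proof. by rewrite -lecR rmorphD/= -!cnormE ler_normD. Qed.

Lemma cnormN a : cnorm (- a) = cnorm a.
Proof. by rewrite /cnorm normrN. Qed.

Lemma cnorm_eq0 a : cnorm a = 0 -> a = 0.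
Proof. by move=> a0; apply/eqP; rewrite -normr_eq0 cnormE a0. Qed.

Lemma cnorm0 : cnorm 0 = 0.
Proof. by rewrite /cnorm normr0. Qed.

Lemma cnorm_sqr a : (cnorm a ^+ 2)%:C = a * Num.conj a.
Proof. by rewrite rmorphXn/= -cnormE normCK. Qed.

Lemma ler_Re_cnorm a : complex.Re a <= cnorm a.
Proof.
rewrite -lecR -cnormE; apply: le_trans (normc_ge_Re a).
by rewrite lecR ler_norm.
Qed.

Lemma exists_invn_le (e : R) : 0 < e -> exists N : nat,
  forall n, (N <= n)%N -> n.+1%:R^-1 <= e.
Proof.
move=> e0; exists (Num.truncn e^-1) => n Nn.
rewrite invf_ple ?posrE//; apply/ltW; apply: lt_le_trans (truncnS_gt _) _.
by rewrite ler_nat ltnS.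
Qed.

Lemma conj_real (r : R) : Num.conj r%:C = r%:C.
Proof. by apply/CrealP/complex_realP; exists r. Qed.

Lemma Re_conj a : complex.Re (Num.conj a) = complex.Re a.
Proof. by apply: complexI; rewrite !complexRe Re_conj. Qed.

Lemma two_Re a : (2 * complex.Re a)%:C = a + Num.conj a.
Proof. by rewrite mulr_natl raddfMn/= complexRe ReE; field. Qed.

Lemma conj_realM a (r : R) :
  complex.Re (Num.conj (a * r%:C) * a) = cnorm a ^+ 2 * r.
Proof.
have -> : Num.conj (a * r%:C) * a = a * Num.conj a * Num.conj r%:C.
  by rewrite rmorphM mulrC mulrA.
by rewrite conj_real -cnorm_sqr -rmorphM.
Qed.

Context {H : hilbertType R}.
Implicit Types x y z : H.

(** Norms take their values in [R[i]], whose order is partial; the real part is an [R]-valued copy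
    for which suprema, comparison and [lra] are available. *)
Definition hnorm x : R := complex.Re `|x|.

Lemma hnormE x : `|x| = (hnorm x)%:C.
Proof. by rewrite /hnorm RRe_real// normr_real. Qed.

Lemma hnorm_ge0 x : 0 <= hnorm x.
Proof. by rewrite -ler0c -hnormE. Qed.
Hint Resolve hnorm_ge0 : core.

Lemma hnormZ a x : hnorm (a *: x) = cnorm a * hnorm x.
Proof. by apply: complexI;
  rewrite rmorphM/= -hnormE -cnormE -hnormE normrZ. Qed.

Lemma hnormZr (r : R) x : hnorm (r%:C *: x) = `|r| * hnorm x.
Proof. by rewrite hnormZ cnorm_real. Qed.

Lemma hnormD x y : hnorm (x + y) <= hnorm x + hnorm y.
Proof. by rewrite -lecR rmorphD/= -!hnormE ler_normD. Qed.

Lemma hnormN x : hnorm (- x) = hnorm x.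
Proof. by rewrite /hnorm normrN. Qed.

Lemma hnormC x y : hnorm (x - y) = hnorm (y - x).
Proof. by rewrite -hnormN opprB. Qed.

Lemma hdist_tri z x y : hnorm (x - y) <= hnorm (x - z) + hnorm (z - y).
Proof. by rewrite -[x in leLHS](subrK z) -addrA hnormD. Qed.

Lemma hnorm_eq0 x : hnorm x = 0 -> x = 0.
Proof. by move=> x0; apply/eqP; rewrite -normr_eq0 hnormE x0. Qed.

Lemma hnorm0 : hnorm 0 = 0.
Proof. by rewrite /hnorm normr0. Qed.

Lemma hnorm_gt0 x : x != 0 -> 0 < hnorm x.
Proof.
by move=> x0; rewrite lt_neqAle hnorm_ge0 andbT eq_sym;
  apply: contra_neq x0 => /hnorm_eq0.
Qed.

Lemma hnorm_le_eps x : (forall e : R, 0 < e -> hnorm x <= e) -> x = 0.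
Proof.
move=> xe; apply: hnorm_eq0; apply/eqP; rewrite eq_le hnorm_ge0 andbT.
by apply/ler_addgt0Pl => e e0; rewrite addr0; exact: xe.
Qed.

Lemma innerDl x y z : inner (x + y) z = inner x z + inner y z.
Proof. exact: linearDl. Qed.

Lemma innerDr x y z : inner x (y + z) = inner x y + inner x z.
Proof. exact: linearDr. Qed.

Lemma innerNl x y : inner (- x) y = - inner x y.
Proof. exact: linearNl. Qed.

Lemma innerNr x y : inner x (- y) = - inner x y.
Proof. exact: linearNr. Qed.

Lemma innerBl x y z : inner (x - y) z = inner x z - inner y z.
Proof. by rewrite innerDl innerNl. Qed.

Lemma innerBr x y z : inner x (y - z) = inner x y - inner x z.
Proof. by rewrite innerDr innerNr. Qed.

Lemma innerZl a x y : inner (a *: x) y = a * inner x y.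
Proof. exact: linearZl_LR. Qed.

Lemma innerZr a x y : inner x (a *: y) = Num.conj a * inner x y.
Proof. exact: linearZr_LR. Qed.

Lemma inner0l y : inner 0 y = 0.
Proof. exact: linear0l. Qed.

Lemma inner0r x : inner x 0 = 0.
Proof. exact: linear0r. Qed.

Lemma innerC x y : inner x y = Num.conj (inner y x).
Proof. by rewrite (hermC inner) expr0 mul1r. Qed.

Lemma inner_suml I (r : seq I) (F : I -> H) y :
  inner (\sum_(i <- r) F i) y = \sum_(i <- r) inner (F i) y.
Proof.
elim: r => [|i r IH]; first by rewrite !big_nil inner0l.
by rewrite !big_cons innerDl IH.
Qed.

Lemma inner_eq0C x y : inner x y = 0 -> inner y x = 0.
Proof. by move=> xy; rewrite innerC xy rmorph0. Qed.

Lemma innerxx x : inner x x = (hnorm x ^+ 2)%:C.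
Proof. by rewrite inner_norm hnormE rmorphXn. Qed.

Lemma innerxx_eq0 x : inner x x = 0 -> x = 0.
Proof.
rewrite innerxx => /complexI/eqP; rewrite sqrf_eq0 => /eqP; exact: hnorm_eq0.
Qed.

Lemma inner_ext x y : (forall z, inner x z = inner y z) -> x = y.
Proof. by move=> xy; apply/subr0_eq/innerxx_eq0; rewrite innerBl xy subrr. Qed.

Lemma hnormD_sqr x y :
  hnorm (x + y) ^+ 2 = hnorm x ^+ 2 + hnorm y ^+ 2 + 2 * complex.Re (inner x y).
Proof.
apply: complexI; rewrite -innerxx !(innerDl, innerDr) (innerC y x).
by rewrite !raddfD/= two_Re -!innerxx; ring.
Qed.

Lemma hnormB_sqr x y :
  hnorm (x - y) ^+ 2 = hnorm x ^+ 2 + hnorm y ^+ 2 - 2 * complex.Re (inner x y).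
Proof. by rewrite hnormD_sqr hnormN innerNr raddfN/= mulrN. Qed.

Lemma pythagoras x y :
  inner x y = 0 -> hnorm (x + y) ^+ 2 = hnorm x ^+ 2 + hnorm y ^+ 2.
Proof. by move=> xy; rewrite hnormD_sqr xy raddf0 mulr0 addr0. Qed.

Lemma parallelogram x y : hnorm (x + y) ^+ 2 + hnorm (x - y) ^+ 2 =
  2 * hnorm x ^+ 2 + 2 * hnorm y ^+ 2.
Proof. by rewrite hnormD_sqr hnormB_sqr; ring. Qed.

(** Nonnegativity of the left side is the Cauchy-Schwarz inequality; the same identity shows that a
    point at minimal distance from a subspace has an orthogonal residual. *)
Lemma hnormB_coef_sqr x y : y != 0 ->
  hnorm (x - (inner x y / inner y y) *: y) ^+ 2 =
  hnorm x ^+ 2 - (cnorm (inner x y) / hnorm y) ^+ 2.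
Proof.
move=> y0; have ny : hnorm y != 0 by rewrite gt_eqF ?hnorm_gt0.
rewrite hnormB_sqr hnormZ innerZr innerxx cnormM cnormV cnorm_real.
rewrite -fmorphV conj_realM ger0_norm ?sqr_ge0//.
by field.
Qed.

Lemma cauchy_schwarz x y : cnorm (inner x y) <= hnorm x * hnorm y.
Proof.
have [->|y0] := eqVneq y 0; first by rewrite inner0r cnorm0 hnorm0 mulr0.
rewrite -ler_pdivrMr ?hnorm_gt0// -(@ler_pXn2r _ 2)//.
- by rewrite -subr_ge0 -hnormB_coef_sqr// sqr_ge0.
- by rewrite nnegrE divr_ge0// cnorm_ge0.
- by rewrite nnegrE.
Qed.

End Hilbert_norm.
#[global] Hint Extern 0 (is_true (@Order.le _ _ _ (hnorm _))) =>
  solve [apply: hnorm_ge0] : core.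
#[global] Hint Extern 0 (is_true (@Order.le _ _ _ (cnorm _))) =>
  solve [apply: cnorm_ge0] : core.

(** * Convergence *)

Section Hilbert_topology.
Context {R : realType} {H : hilbertType R}.
Implicit Types (x y : H) (u v : nat -> H) (M : set H).

Definition hcvg u x := forall e : R, 0 < e ->
  exists N, forall n, (N <= n)%N -> hnorm (u n - x) <= e.

Lemma nbhs_hnormP x (A : set H) :
  nbhs x A <-> exists2 e : R, 0 < e & forall y, hnorm (x - y) < e -> A y.
Proof.
split=> [/nbhs_ballP[e /= e0 eA]|[e e0 eA]].
  have eE : e = (complex.Re e)%:C by rewrite RRe_real// gtr0_real.
  exists (complex.Re e); first by rewrite -ltcR -eE.
  move=> y xy; apply: eA; rewrite -ball_normE/= hnormE eE ltcR//.
apply/nbhs_ballP; exists e%:C => /=; first by rewrite ltcR.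
by move=> y; rewrite -ball_normE/= hnormE ltcR; exact: eA.
Qed.

Lemma hcauchy_hcvg u :
  (forall e : R, 0 < e -> exists N, forall m n, (N <= m)%N -> (N <= n)%N ->
     hnorm (u m - u n) <= e) -> exists x, hcvg u x.
Proof.
move=> cu; have : cauchy (u @ \oo).
  apply/cauchy_ballP => e e0.
  have eE : e = (complex.Re e)%:C by rewrite RRe_real// gtr0_real.
  have : 0 < complex.Re e / 2 by rewrite divr_gt0// -ltcR -eE.
  move=> /cu[N uN].
  exists (u @` [set n | (N <= n)%N], u @` [set n | (N <= n)%N]) => /=.
    by split; exists N => // n /= Nn; exists n.
  move=> [_ _] /= [[m Nm <-] [n Nn <-]].
  rewrite -ball_normE/= hnormE eE ltcR; apply: le_lt_trans (uN _ _ Nm Nn) _.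
  by rewrite ltr_pdivrMr// ltr_pMr ?ltr1n// -ltcR -eE.
move=> /cauchy_cvg/cvg_ex[x /= ux]; exists x => e e0.
have /ux[N _ uN] : nbhs x [set y | hnorm (y - x) <= e].
  by apply/nbhs_hnormP; exists e => // y /ltW; rewrite hnormC.
by exists N => n /uN.
Qed.

Lemma closed_hnorm M x : closed M ->
  (forall e : R, 0 < e -> exists2 y, M y & hnorm (x - y) < e) -> M x.
Proof.
move=> cM xM; apply: cM => A /nbhs_hnormP[e e0 eA].
by have [y My xy] := xM _ e0; exists y; split => //; exact: eA.
Qed.

(** Compactness is used through a cluster point of the image sequence, which is approached beyond
    every rank; no subsequence is extracted. *)
Lemma compact_op_cluster (T : H -> H) u : compact_op T ->
  (forall n, hnorm (u n) <= 1) ->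
  exists y, forall (e : R) N, 0 < e ->
    exists2 n, (N <= n)%N & hnorm (T (u n) - y) < e.
Proof.
move=> cT u1; have [|y [_ cy]] := cT ((T \o u) @ \oo).
  exists 0%N => // n _ /=; apply: subset_closure; exists (u n) => //=.
    by rewrite hnormE lecR.
exists y => e N e0.
have [||z [[n Nn <-] /= yz]] :=
    cy ((T \o u) @` [set n | (N <= n)%N]) [set z | hnorm (z - y) < e].
- by exists N => // n /= Nn; exists n.
- by apply/nbhs_hnormP; exists e => // z; rewrite hnormC.
by exists n.
Qed.

Lemma hcvg_unique u x y : hcvg u x -> hcvg u y -> x = y.
Proof.
move=> ux uy; apply/subr0_eq/hnorm_le_eps => e e0.
have e2 : 0 < e / 2 by rewrite divr_gt0.
have [[M uM] [N uN]] := (ux _ e2, uy _ e2).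
have := uM _ (leq_maxl M N); have := uN _ (leq_maxr M N).
have := hdist_tri (u (maxn M N)) x y; rewrite (hnormC x (u _)).
lra.
Qed.

Lemma hcvgD u v x y : hcvg u x -> hcvg v y -> hcvg (fun n => u n + v n) (x + y).
Proof.
move=> ux vy e e0; have e2 : 0 < e / 2 by rewrite divr_gt0.
have [[M uM] [N vN]] := (ux _ e2, vy _ e2); exists (maxn M N) => n.
rewrite geq_max => /andP[/uM Mn /vN Nn].
rewrite opprD addrACA; apply: le_trans (hnormD _ _) _; lra.
Qed.

Lemma hcvg_dominated u v (c : R) x y :
  (forall n, hnorm (v n - y) <= c * hnorm (u n - x)) -> hcvg u x -> hcvg v y.
Proof.
move=> vu ux e e0; have c1 : 0 < `|c| + 1 by rewrite ltr_wpDl.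
have [N uN] := ux _ (divr_gt0 e0 c1); exists N => n /uN.
rewrite ler_pdivlMr// => h; apply: le_trans (vu n) _; apply: le_trans h.
by rewrite [leRHS]mulrC; apply: ler_wpM2r => //;
  rewrite (le_trans (ler_norm c))// lerDl.
Qed.

Lemma hcvgZ (a : R[i]) u x : hcvg u x -> hcvg (fun n => a *: u n) (a *: x).
Proof.
by apply: (@hcvg_dominated _ _ (cnorm a)) => n; rewrite -scalerBr hnormZ.
Qed.

Lemma hcvg_hnorm_le u x (c : R) :
  hcvg u x -> (forall n, hnorm (u n) <= c) -> hnorm x <= c.
Proof.
move=> ux uc; apply/ler_addgt0Pr => e e0.
have [N /(_ _ (leqnn N)) uN] := ux _ e0; have := uc N.
by have := hdist_tri (u N) x 0; rewrite !subr0 (hnormC x); lra.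
Qed.

Lemma hcvg_shift u x : hcvg u x -> hcvg (fun n => u n.+1) x.
Proof. by move=> ux e /ux[N uN]; exists N => n Nn; apply: uN; exact: leqW. Qed.

Lemma hcvg_cst x : hcvg (fun=> x) x.
Proof. by move=> e e0; exists 0%N => n _; rewrite subrr hnorm0 ltW. Qed.

End Hilbert_topology.

(** * Bounded operators and orthogonal projections *)

Section bounded_operators.
Context {R : realType} {H : hilbertType R}.
Implicit Types (x y z : H) (S T : H -> H) (M : set H).

Lemma bounded_opP T : bounded_op T <->
  linear T /\ exists2 c : R, 0 <= c & forall x, hnorm (T x) <= c * hnorm x.
Proof.
split=> -[lT [c]] => [Tc|c0 Tc]; split=> //; last first.
  by exists c%:C => x; rewrite !hnormE -rmorphM/= lecR.
exists (cnorm c) => // x; rewrite -lecR rmorphM/= -cnormE -!hnormE.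
rewrite -[`|x| in leRHS]normr_id -normrM ger0_norm//.
exact: le_trans (Tc x).
Qed.

Lemma bounded_opD T x y : bounded_op T -> T (x + y) = T x + T y.
Proof. by case=> lT _; have := lT 1 x y; rewrite !scale1r. Qed.

Lemma bounded_op0 T : bounded_op T -> T 0 = 0.
Proof. by case=> lT _; have := lT (-1) 0 0;
  rewrite !scaleN1r oppr0 addr0 addNr. Qed.

Lemma bounded_opZ T a x : bounded_op T -> T (a *: x) = a *: T x.
Proof.
by move=> bT; case: (bT) => lT _; have := lT a x 0;
  rewrite (bounded_op0 bT) !addr0.
Qed.

Lemma bounded_opN T x : bounded_op T -> T (- x) = - T x.
Proof. by move=> bT; rewrite -scaleN1r bounded_opZ// scaleN1r. Qed.

Lemma bounded_opB T x y : bounded_op T -> T (x - y) = T x - T y.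
Proof. by move=> bT; rewrite bounded_opD// bounded_opN. Qed.

Lemma bounded_op_sum T I (r : seq I) (F : I -> H) : bounded_op T ->
  T (\sum_(i <- r) F i) = \sum_(i <- r) T (F i).
Proof.
move=> bT; elim: r => [|i r IH]; first by rewrite !big_nil bounded_op0.
by rewrite !big_cons bounded_opD// IH.
Qed.

Lemma bounded_op_comp S T : bounded_op S -> bounded_op T -> bounded_op (S \o T).
Proof.
move=> /bounded_opP[lS [c c0 Sc]] /bounded_opP[lT [d d0 Td]].
apply/bounded_opP; split=> [a x y /=|]; first by rewrite lT lS.
exists (c * d) => [|x]; first exact: mulr_ge0.
by rewrite -mulrA; apply: le_trans (Sc _) _; rewrite ler_wpM2l.
Qed.

Lemma bounded_op_add S T : bounded_op S -> bounded_op T -> bounded_op (S \+ T).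
Proof.
move=> /bounded_opP[lS [c c0 Sc]] /bounded_opP[lT [d d0 Td]].
apply/bounded_opP; split=> [a x y /=|].
  by rewrite lT lS scalerDr addrACA.
exists (c + d) => [|x]; first exact: addr_ge0.
by rewrite mulrDl; apply: le_trans (hnormD _ _) _; rewrite lerD.
Qed.

Lemma bounded_op_scale a T : bounded_op T -> bounded_op (fun x => a *: T x).
Proof.
move=> /bounded_opP[lT [d d0 Td]]; apply/bounded_opP; split=> [b x y|].
  by rewrite lT scalerDr !scalerA (mulrC a).
exists (cnorm a * d) => [|x]; first exact: mulr_ge0.
by rewrite hnormZ -mulrA ler_wpM2l.
Qed.

Lemma bounded_op_opp T : bounded_op T -> bounded_op (fun x => - T x).
Proof.
move=> /bounded_opP[lT [d d0 Td]]; apply/bounded_opP; split=> [b x y|].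
  by rewrite lT opprD scalerN.
by exists d => // x; rewrite hnormN.
Qed.

Lemma bounded_op_sub S T : bounded_op S -> bounded_op T -> bounded_op (S \- T).
Proof. by move=> bS bT; apply: bounded_op_add => //; exact: bounded_op_opp. Qed.

Lemma bounded_op_zero : bounded_op (fun=> 0 : H).
Proof.
apply/bounded_opP; split=> [a x y|]; first by rewrite scaler0 addr0.
by exists 0 => // x; rewrite hnorm0 mul0r.
Qed.

Lemma bounded_op_id : bounded_op (@id H).
Proof. by apply/bounded_opP; split=> //; exists 1 => // x; rewrite mul1r. Qed.

Lemma bounded_op_hcvg T u x : bounded_op T -> hcvg u x ->
  hcvg (fun n => T (u n)) (T x).
Proof.
move=> bT; have /bounded_opP[_ [c c0 Tc]] := bT.
by apply: (@hcvg_dominated _ _ _ _ c) => n; rewrite -bounded_opB.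
Qed.

Definition subspace M :=
  M 0 /\ forall a x y, M x -> M y -> M (a *: x + y).

Lemma subspaceD M x y : subspace M -> M x -> M y -> M (x + y).
Proof. by move=> sM Mx My; rewrite -[x]scale1r; apply sM. Qed.

Lemma subspaceZ M a x : subspace M -> M x -> M (a *: x).
Proof. by move=> sM Mx; rewrite -[_ *: _]addr0; apply sM => //; apply sM. Qed.

Lemma subspaceB M x y : subspace M -> M x -> M y -> M (x - y).
Proof. by move=> sM Mx My; rewrite addrC -scaleN1r; apply sM. Qed.

Lemma subspace_range T : bounded_op T -> subspace (range T).
Proof.
move=> bT; split; first by exists 0 => //; rewrite bounded_op0.
by move=> a _ _ [x _ <-] [y _ <-]; exists (a *: x + y) => //; apply bT.
Qed.

Definition hclosed M := forall x,
  (forall e : R, 0 < e -> exists2 y, M y & hnorm (x - y) < e) -> M x.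

Lemma hclosed_hcvg M u x : hclosed M -> (forall n, M (u n)) -> hcvg u x -> M x.
Proof.
move=> cM Mu ux; apply: cM => e e0; have [|N uN] := ux (e / 2).
  by rewrite divr_gt0.
exists (u N) => //; rewrite hnormC; apply: le_lt_trans (uN _ (leqnn N)) _.
by rewrite ltr_pdivrMr// ltr_pMr// ltr1n.
Qed.

Lemma inner_small x y : (forall e : R, 0 < e -> exists2 z, inner z y = 0 &
  hnorm (x - z) < e) -> inner x y = 0.
Proof.
move=> xe; apply: cnorm_eq0; apply/eqP; rewrite eq_le cnorm_ge0 andbT.
apply/ler_addgt0Pl => e e0; rewrite addr0.
have y1 : 0 < hnorm y + 1 by rewrite ltr_wpDl.
have [z zy xz] := xe _ (divr_gt0 e0 y1).
have -> : inner x y = inner (x - z) y by rewrite innerBl zy subr0.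
apply: le_trans (cauchy_schwarz _ _) _; move: xz; rewrite ltr_pdivlMr// => /ltW.
by apply: le_trans; apply: ler_wpM2l => //; rewrite lerDl.
Qed.

Lemma subspace_orthc M : subspace (orthc M).
Proof.
split=> [y _|a x y Mx My z Mz]; first exact: inner0l.
by rewrite innerDl innerZl Mx// My// mulr0 addr0.
Qed.

Lemma hclosed_orthc M : hclosed (orthc M).
Proof.
by move=> x xe y My; apply: inner_small => e /xe[z Mz xz]; exists z => //;
  apply Mz.
Qed.

Lemma orthogonal_projection M x : subspace M -> hclosed M ->
  exists2 y, M y & orthc M (x - y).
Proof.
move=> sM cM; pose D := [set hnorm (x - y) | y in M]; pose d := inf D.
have D0 : has_inf D.
  split; first by exists (hnorm (x - 0)), 0 => //; apply sM.
  by exists 0 => _ [y _ <-]; exact: hnorm_ge0.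
have dD y : M y -> d <= hnorm (x - y) by move=> My; apply: ge_inf D0.2 _ _;
  exists y.
have d0 : 0 <= d by apply: lb_le_inf D0.1 _ => _ [y _ <-]; exact: hnorm_ge0.
have /choice[u uP] (n : nat) : exists y, M y /\ hnorm (x - y) < d + n.+1%:R^-1.
  have [|_ [y My <-] xy] := inf_adherent (eps := n.+1%:R^-1) _ D0.
    by rewrite invr_gt0.
  by exists y.
(* With e = 1/(N+1), the distances of [x] to [u m] and [u n] are at most d + e and that to their
   midpoint is at least d. The parallelogram law then bounds the left side by 4 ((d + e)^2 - d^2),
   at most 4 (2 d + 1) e since e <= 1. *)
have cauchy_u (m n N : nat) : (N <= m)%N -> (N <= n)%N ->
    hnorm (u m - u n) ^+ 2 <= 4 * (2 * d + 1) / N.+1%:R.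
  move=> Nm Nn.
  have le_inv k : (N <= k)%N -> k.+1%:R^-1 <= N.+1%:R^-1 :> R.
    by move=> Nk; rewrite lef_pV2 ?posrE// ler_nat ltnS.
  have := parallelogram (x - u m) (x - u n).
  have -> : x - u m - (x - u n) = u n - u m by rewrite opprB addrC addrA subrK.
  have -> : x - u m + (x - u n) =
      (2 : R)%:C *: (x - (2^-1 : R)%:C *: (u m + u n)).
    rewrite scalerBr scalerA -rmorphM/= divff// scale1r.
    by rewrite addrACA -opprD -mulr2n -scaler_nat raddfMn.
  rewrite hnormZr ger0_norm// (hnormC (u n)).
  have := dD _ (subspaceZ (2^-1)%:C sM (subspaceD sM (uP m).1 (uP n).1)).
  move: (uP m).2 (uP n).2 (le_inv _ Nm) (le_inv _ Nn) (hnorm_ge0 (x - u m)).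
  move: (hnorm_ge0 (x - u n)).
  have : N.+1%:R^-1 <= 1 :> R by rewrite invf_le1// ler1n.
  have : 0 < N.+1%:R^-1 :> R by rewrite invr_gt0.
  set e := N.+1%:R^-1; set b := hnorm (x - u n); set a := hnorm (x - u m).
  set f := hnorm (x - _ *: _); set g :=
    hnorm (u m - u n) => e0 e1 b0 be ae me ne a0 df.
  have a1 : a <= d + e by apply/ltW/(lt_le_trans be); rewrite lerD2l.
  have b1 : b <= d + e by apply/ltW/(lt_le_trans ae); rewrite lerD2l.
  clear be ae me ne le_inv; clearbody e a b f g.
  have a2 : a ^+ 2 <= (d + e) ^+ 2 by rewrite ler_pXn2r// nnegrE; lra.
  have b2 : b ^+ 2 <= (d + e) ^+ 2 by rewrite ler_pXn2r// nnegrE; lra.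
  have f2 : d ^+ 2 <= f ^+ 2 by rewrite ler_pXn2r// nnegrE; lra.
  have ee : e ^+ 2 <= e by rewrite expr2 ler_piMl//; lra.
  rewrite exprMn => par.
  have -> : g ^+ 2 = 2 * a ^+ 2 + 2 * b ^+ 2 - 2 ^+ 2 * f ^+ 2 by lra.
  nra.
have [y uy] : exists y, hcvg u y.
  apply: hcauchy_hcvg => e e0.
  have K0 : 0 < 4 * (2 * d + 1) by lra.
  have [N NP] := exists_invn_le (divr_gt0 (exprn_gt0 2 e0) K0).
  exists N => m n Nm Nn; rewrite -ler_sqr ?nnegrE ?(ltW e0)//.
  apply: le_trans (cauchy_u _ _ _ Nm Nn) _.
  by rewrite mulrC -ler_pdivlMr// NP.
have My : M y by apply: hclosed_hcvg uy => // n; exact: (uP n).1.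
have xy : hnorm (x - y) <= d.
  apply/ler_addgt0Pr => e e0; have e2 : 0 < e / 2 by rewrite divr_gt0.
  have [[N uN] [N' NP]] := (uy _ e2, exists_invn_le e2); set n := maxn N N'.
  have := uN _ (leq_maxl _ _ : (N <= n)%N); have := (uP n).2.
  have := NP _ (leq_maxr _ _ : (N' <= n)%N).
  have := hdist_tri (u n) x y; move: (n.+1%:R^-1) => k; lra.
exists y => // z Mz; have [->|z0] := eqVneq z 0; first exact: inner0r.
(* Moving [y] along [z] by the optimal coefficient cannot bring it closer than d, so the gain (|<x -
   y, z>| / |z|)^2 is zero. *)
have := dD _ (subspaceD sM My (subspaceZ (inner (x - y) z / inner z z) sM Mz)).
rewrite opprD addrA => dz.
have := hnormB_coef_sqr (x - y) z0; set w := _ - _ *: _ => wE.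
have : d ^+ 2 <= hnorm w ^+ 2 by rewrite ler_pXn2r// nnegrE.
have : hnorm (x - y) ^+ 2 <= d ^+ 2 by rewrite ler_pXn2r// nnegrE.
rewrite wE => h1 h2; apply: cnorm_eq0; apply/eqP.
have /eqP : (cnorm (inner (x - y) z) / hnorm z) ^+ 2 = 0.
  by apply/eqP; rewrite eq_le sqr_ge0 andbT; lra.
by rewrite sqrf_eq0 mulf_eq0 invr_eq0 (gt_eqF (hnorm_gt0 z0)) orbF.
Qed.

End bounded_operators.

(** * Projection operators, Riesz representation and adjoints *)

Section projection_adjoint.
Context {R : realType} {H : hilbertType R}.
Implicit Types (x y z : H) (S T : H -> H) (M : set H).

Definition proj M x : H := xget 0 [set y | M y /\ orthc M (x - y)].

Lemma projP M x : subspace M -> hclosed M ->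
  M (proj M x) /\ orthc M (x - proj M x).
Proof.
move=> sM cM; rewrite /proj; case: xgetP => [y -> //|nP].
by have [y My xy] := orthogonal_projection x sM cM; case: (nP y).
Qed.

Lemma proj_unique M x y : subspace M -> hclosed M ->
  M y -> orthc M (x - y) -> proj M x = y.
Proof.
move=> sM cM My xy; have [Mp xp] := projP x sM cM.
apply/subr0_eq/innerxx_eq0; set w := _ - y; have Mw : M w by exact: subspaceB.
have wE : w = (x - y) - (x - proj M x) by rewrite opprB addrC subrKA.
by rewrite {1}wE innerBl xy// xp// subrr.
Qed.

Lemma hnorm_proj M x : subspace M -> hclosed M -> hnorm (proj M x) <= hnorm x.
Proof.
move=> sM cM; have [Mp xp] := projP x sM cM.
rewrite -ler_sqr ?nnegrE//; have := pythagoras (xp _ Mp); rewrite subrK => ->.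
by rewrite lerDr sqr_ge0.
Qed.

Lemma bounded_op_proj M : subspace M -> hclosed M -> bounded_op (proj M).
Proof.
move=> sM cM; apply/bounded_opP; split=> [a x y|]; last first.
  by exists 1 => // x; rewrite mul1r hnorm_proj.
have [[Mx px] [My py]] := (projP x sM cM, projP y sM cM).
apply: proj_unique => //; first exact: sM.2.
by rewrite opprD addrACA -scalerBr; apply (subspace_orthc M).2.
Qed.

Lemma proj_id M x : subspace M -> hclosed M -> M x -> proj M x = x.
Proof.
by move=> sM cM Mx; apply: proj_unique => // y _; rewrite subrr inner0l.
Qed.

Lemma inner_proj M x y : subspace M -> hclosed M ->
  inner (proj M x) y = inner (proj M x) (proj M y).
Proof.
move=> sM cM; have [[Mx px] [My py]] := (projP x sM cM, projP y sM cM).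
by rewrite -[y in LHS](subrK (proj M y)) innerDr (inner_eq0C (py _ Mx)) add0r.
Qed.

(** The functional is x |-> <T x, y>, so that the representing vector is the value at [y] of the
    adjoint. For z orthogonal to its kernel [N], the vector <T x, y> z - <T z, y> x lies in [N],
    hence is orthogonal to z, which expresses <T x, y> as a multiple of <x, z>. *)
Lemma riesz T y : bounded_op T -> exists z, forall x, inner (T x) y = inner x z.
Proof.
move=> bT; pose N := [set x | inner (T x) y = 0].
have sN : subspace N.
  split; first by rewrite /N/= bounded_op0// inner0l.
  move=> a x z; rewrite /N/= bounded_opD// bounded_opZ// innerDl innerZl.
  by move=> -> ->; rewrite mulr0 addr0.
have cN : hclosed N.
  have /bounded_opP[_ [c c0 Tc]] := bT.
  move=> x xN; apply: inner_small => e e0.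
  have c1 : 0 < c + 1 by rewrite ltr_wpDl.
  have [z Nz xz] := xN _ (divr_gt0 e0 c1); exists (T z) => //.
  rewrite -bounded_opB//; apply: le_lt_trans (Tc _) _.
  move: xz; rewrite ltr_pdivlMr// mulrDr mulr1 mulrC; apply: le_lt_trans.
  by rewrite lerDl.
have [allN|/existsNP[x0 Nx0]] := pselect (forall x, N x).
  by exists 0 => x; rewrite inner0r; exact: allN.
have [Np zN] := projP x0 sN cN.
pose z := x0 - proj N x0; pose fz := inner (T z) y.
have fz0 : fz != 0.
  apply/eqP => fz0; apply: Nx0; rewrite -[x0](subrK (proj N x0)).
  exact: subspaceD.
have z0 : z != 0.
  by apply: contra_neq fz0 => z0; rewrite /fz z0 bounded_op0// inner0l.
have zz0 : inner z z != 0.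
  by rewrite innerxx fmorph_eq0 sqrf_eq0 gt_eqF ?hnorm_gt0.
exists (Num.conj (fz / inner z z) *: z) => x.
have : inner (inner (T x) y *: z - fz *: x) z = 0.
  apply: inner_eq0C; apply: zN;
    rewrite /N/= (bounded_opB _ _ bT) !(bounded_opZ _ _ bT).
  by rewrite innerBl !innerZl mulrC subrr.
rewrite innerBl !innerZl => /subr0_eq xz.
by rewrite innerZr conjCK mulrAC -xz mulfK.
Qed.

Lemma adjointP T : bounded_op T ->
  bounded_op (adjoint T) /\ forall x y, inner (T x) y = inner x (adjoint T y).
Proof.
move=> bT; rewrite /adjoint; case: xgetP => [S _ //|nS]; exfalso.
have /choice[S TS] y := riesz y bT; apply: (nS S); split => //.
have /bounded_opP[_ [c c0 Tc]] := bT.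
apply/bounded_opP; split=> [a x y|].
  apply: inner_ext => z; rewrite innerC -TS innerDr innerZr !TS.
  by rewrite innerDl innerZl rmorphD rmorphM/= conjCK -!innerC.
exists c => // y; have [->|Sy] := eqVneq (S y) 0.
  by rewrite hnorm0 mulr_ge0.
rewrite -(ler_pM2l (hnorm_gt0 Sy)) -expr2.
have -> : hnorm (S y) ^+ 2 = cnorm (inner (T (S y)) y).
  by rewrite TS innerxx cnorm_real ger0_norm ?sqr_ge0.
apply: le_trans (cauchy_schwarz _ _) _.
by rewrite mulrA ler_wpM2r// mulrC.
Qed.

Lemma inner_adjointl T x y : bounded_op T ->
  inner (adjoint T x) y = inner x (T y).
Proof. by move=> bT; rewrite innerC -(adjointP bT).2 -innerC. Qed.

(** Polarization: the quadratic form is real at x + y and at x + i y, and these two facts together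
    identify <T x, y> with the conjugate of <T y, x>. *)
Lemma psd_selfadjoint T x y : psd T -> inner (T x) y = inner x (T y).
Proof.
move=> [bT T0]; have realT z : Num.conj (inner (T z) z) = inner (T z) z.
  exact/CrealP/ger0_real.
have h z w : inner (T z) w + inner (T w) z =
    Num.conj (inner (T z) w) + Num.conj (inner (T w) z).
  move: (realT (z + w)); rewrite bounded_opD// !(innerDl, innerDr) !rmorphD/=.
  rewrite !realT => e; apply: (addrI (inner (T z) z + inner (T w) w)).
  transitivity (inner (T z) z + inner (T z) w + (inner (T w) z + inner (T w)
    w)).
    by ring.
  by rewrite -e; ring.
have /= h1 := h x y; have := h x ('i *: y).
rewrite (bounded_opZ _ _ bT) innerZl innerZr conjCi.
move: h1; rewrite [inner x (T y)]innerC.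
set a := inner (T x) y; set b := inner (T y) x.
have -> : Num.conj (- 'i * a) = 'i * Num.conj a.
  by rewrite rmorphM rmorphN/= conjCi opprK.
have -> : Num.conj ('i * b) = - 'i * Num.conj b by rewrite rmorphM/= conjCi.
move=> h1 h2.
have i0 : 'i != 0 :> R[i] by exact: neq0Ci.
have {}h2 : b - a = Num.conj a - Num.conj b.
  by apply: (mulfI i0); rewrite mulrBr -mulNr addrC h2; ring.
apply: (@mulfI _ 2) => //.
transitivity ((a + b) - (b - a)); first by ring.
by rewrite h1 h2; ring.
Qed.

Lemma psd_inner_sqr T x : psd T ->
  hnorm (T x) ^+ 2 = complex.Re (inner (T (T x)) x).
Proof. by move=> pT; rewrite psd_selfadjoint// innerxx. Qed.

End projection_adjoint.

(** * Positive square roots *)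

Section square_root.
Context {R : realType} {H : hilbertType R}.
Implicit Types (x y z : H) (S T : H -> H).

Lemma hcvg_inner_eq u v x y z w : hcvg u x -> hcvg v w ->
  (forall n, inner (u n) y = inner z (v n)) -> inner x y = inner z w :> R[i].
Proof.
move=> ux vw uv; apply/subr0_eq/cnorm_eq0/eqP; rewrite eq_le cnorm_ge0 andbT.
apply/ler_addgt0Pl => e e0; rewrite addr0.
have c0 : 0 < hnorm y + hnorm z + 1 by rewrite ltr_wpDl// addr_ge0.
have e2 := divr_gt0 e0 c0.
have [[M uM] [N vN]] := (ux _ e2, vw _ e2).
have := uM _ (leq_maxl M N); have := vN _ (leq_maxr M N); set n := maxn M N.
rewrite !ler_pdivlMr// => hv hu.
have -> : inner x y - inner z w = - (inner (u n - x) y - inner z (v n - w)).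
  by rewrite innerBl innerBr uv; ring.
rewrite cnormN; apply: le_trans (cnormD _ _) _; rewrite cnormN.
have := cauchy_schwarz (u n - x) y; have := cauchy_schwarz z (v n - w).
move: hu hv (hnorm_ge0 y) (hnorm_ge0 z) (hnorm_ge0 (u n - x)) (hnorm_ge0 (v n -
  w)).
move: (hnorm (u n - x)) (hnorm (v n - w)) (hnorm y) (hnorm z).
move: c0 => _ a b c d *; have [ab|/ltW ab] := leP a b; nra.
Qed.

(* Expand 0 <= <T (x - T x), x - T x>. *)
Lemma psd_contraction_sqr T x : psd T -> (forall y, hnorm (T y) <= hnorm y) ->
  hnorm (T x) ^+ 2 <= complex.Re (inner (T x) x).
Proof.
move=> pT T1; have [bT T0] := pT.
have := T0 (x - T x); rewrite bounded_opB// innerBl !innerBr.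
rewrite (psd_selfadjoint (T x) x pT) !innerxx.
have h : complex.Re (inner (T (T x)) (T x)) <= hnorm (T x) ^+ 2.
  apply: le_trans (ler_Re_cnorm _) _; apply: le_trans (cauchy_schwarz _ _) _.
  by rewrite expr2 ler_wpM2r.
by rewrite lecE => /andP[_] /=; rewrite !raddfB/=; lra.
Qed.

Section contraction_root.
Variable K : H -> H.
Hypothesis bK : bounded_op K.
Hypothesis K1 : forall x, hnorm (K x) <= hnorm x.
Hypothesis symK : forall x y, inner (K x) y = inner x (K y).

(* Y_(n+1) = (K + Y_n^2) / 2; if Y_n tends to Y then (1 - Y)^2 = 1 - K. *)
Fixpoint root_iter n : H -> H :=
  if n is m.+1 then
    fun x => (2^-1 : R)%:C *: (K x + root_iter m (root_iter m x))
  else fun=> 0.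

(* The same recursion at the scalar 1, which bounds the norms of the iterates
   and of their differences. *)
Fixpoint scalar_iter n : R :=
  if n is m.+1 then (1 + scalar_iter m ^+ 2) / 2 else 0.

Local Notation Y := root_iter.
Local Notation q := scalar_iter.

Lemma scalar_iter_bound n : 0 <= q n <= 1.
Proof.
elim: n => [|n /andP[q0 q1]] /=; first by rewrite lexx ler01.
have : q n ^+ 2 <= 1 by rewrite exprn_ile1.
by have := sqr_ge0 (q n); move=> *; apply/andP; split; lra.
Qed.

Lemma scalar_iterS n : q n <= q n.+1.
Proof. by rewrite /=; have := sqr_ge0 (q n - 1); rewrite sqrrB expr1n mulr1;
  lra. Qed.

Lemma scalar_iter_le m n : (m <= n)%N -> q m <= q n.
Proof.
elim: n => [|n IH]; first by rewrite leqn0 => /eqP ->.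
rewrite leq_eqVlt => /predU1P[-> //|]; rewrite ltnS => /IH/le_trans; apply.
exact: scalar_iterS.
Qed.

Lemma bounded_root_iter n : bounded_op (Y n).
Proof.
elim: n => [|n IH] /=; first exact: bounded_op_zero.
apply: bounded_op_scale; apply: bounded_op_add => //; exact: bounded_op_comp.
Qed.

Lemma root_iter_norm n x : hnorm (Y n x) <= q n * hnorm x.
Proof.
elim: n x => [|n IH] x /=; first by rewrite hnorm0 mul0r.
rewrite hnormZr ger0_norm// mulrC.
have /andP[q0 _] := scalar_iter_bound n.
have h : hnorm (Y n (Y n x)) <= q n ^+ 2 * hnorm x.
  by apply: le_trans (IH _) _; rewrite expr2 -mulrA ler_wpM2l.
have := le_trans (hnormD _ _) (lerD (K1 x) h).
by lra.
Qed.

(** Each iterate is a polynomial in [K], hence commutes with whatever commutes with [K], in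
    particular with the other iterates. *)
Lemma root_iter_comm (Z : H -> H) n x : bounded_op Z ->
  (forall y, Z (K y) = K (Z y)) -> Z (Y n x) = Y n (Z x).
Proof.
move=> bZ ZK; elim: n x => [|n IH] x /=; first exact: bounded_op0.
by rewrite bounded_opZ// bounded_opD// ZK !IH.
Qed.

Lemma root_iterC m n x : Y m (Y n x) = Y n (Y m x).
Proof.
apply: root_iter_comm; first exact: bounded_root_iter.
by move=> y; rewrite [RHS]root_iter_comm.
Qed.

(** Since the iterates commute, Y_(n+2) - Y_(n+1) = (Y_(n+1) + Y_n) (Y_(n+1) - Y_n) / 2; the scalar
    recursion factors in the same way, and the induction carries the bound over. *)
Lemma root_iterS_dist n x :
  hnorm (Y n.+1 x - Y n x) <= (q n.+1 - q n) * hnorm x.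
Proof.
elim: n x => [|n IH] x.
  have := root_iter_norm 1 x; by rewrite /= !subr0.
have bY := bounded_root_iter.
have -> : Y n.+2 x - Y n.+1 x =
    (2^-1 : R)%:C *: (Y n.+1 (Y n.+1 x - Y n x) + Y n (Y n.+1 x - Y n x)).
  transitivity ((2^-1 : R)%:C *: (K x + Y n.+1 (Y n.+1 x)) -
                (2^-1 : R)%:C *: (K x + Y n (Y n x))) => //.
  rewrite -scalerBr; congr (_ *: _);
    rewrite !(bounded_opB _ _ (bY _)) (root_iterC n n.+1) opprD addrACA subrr
    add0r.
  by rewrite subrKA.
rewrite hnormZr ger0_norm//; set d := _ - _.
have qn := scalar_iter_bound; have /andP[q0 _] := qn n; have /andP[q1 _] :=
  qn n.+1.
have h1 : hnorm (Y n.+1 d) <= q n.+1 * ((q n.+1 - q n) * hnorm x).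
  apply: le_trans (root_iter_norm _ _) _; apply: (ler_wpM2l q1); exact: IH.
have h2 : hnorm (Y n d) <= q n * ((q n.+1 - q n) * hnorm x).
  apply: le_trans (root_iter_norm _ _) _; apply: (ler_wpM2l q0); exact: IH.
have -> : q n.+2 - q n.+1 = 2^-1 * (q n.+1 + q n) * (q n.+1 - q n).
  transitivity ((1 + q n.+1 ^+ 2) / 2 - (1 + q n ^+ 2) / 2) => //.
  by move: (q n.+1) (q n) => a b; field.
rewrite -!mulrA ler_pM2l ?invr_gt0// mulrDl.
exact: le_trans (hnormD _ _) (lerD h1 h2).
Qed.

Lemma root_iter_dist m n x : (m <= n)%N ->
  hnorm (Y n x - Y m x) <= (q n - q m) * hnorm x.
Proof.
elim: n => [|n IH]; first by rewrite leqn0 => /eqP ->;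
  rewrite !subrr hnorm0 mul0r.
rewrite leq_eqVlt => /predU1P[->|]; first by rewrite !subrr hnorm0 mul0r.
rewrite ltnS => /IH h; apply: le_trans (hdist_tri (Y n x) _ _) _.
by have := root_iterS_dist n x; lra.
Qed.

Lemma scalar_iter_cauchy (e : R) : 0 < e ->
  exists N, forall m n, (N <= m)%N -> (N <= n)%N -> q n - q m <= e.
Proof.
move=> e0; pose Q := range q.
have Qs : has_sup Q.
  split; first by exists (q 0), 0%N.
  by exists 1 => _ [n _ <-]; have /andP[] := scalar_iter_bound n.
have [_ [N _ <-] Ne] := sup_adherent e0 Qs; exists N => m n Nm Nn.
have := scalar_iter_le Nm; have : q n <= sup Q by apply: ub_le_sup Qs.2 _ _;
  exists n.
by move: Ne; lra.
Qed.

(** The iterates converge pointwise because the scalar sequence, nondecreasing and bounded by 1, is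
    Cauchy; the bound, the symmetry and the recursion pass to the limit. *)
Lemma contraction_root_ex : exists Y' : H -> H, [/\ bounded_op Y',
  forall x, hnorm (Y' x) <= hnorm x,
  forall x y, inner (Y' x) y = inner x (Y' y) &
  forall x, Y' x = (2^-1 : R)%:C *: (K x + Y' (Y' x))].
Proof.
have bY := bounded_root_iter.
have Y1 n x : hnorm (Y n x) <= hnorm x.
  apply: le_trans (root_iter_norm _ _) _; have /andP[_ q1] :=
    scalar_iter_bound n.
  by rewrite ler_piMl.
have /choice[Y' YY'] x : exists y, hcvg (fun n => Y n x) y.
  apply: hcauchy_hcvg => e e0; have c0 : 0 < hnorm x + 1 by rewrite ltr_wpDl.
  have [N qN] := scalar_iter_cauchy (divr_gt0 e0 c0); exists N => m n Nm Nn.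
  have key m' n' : (N <= m')%N -> (N <= n')%N -> (m' <= n')%N ->
      hnorm (Y n' x - Y m' x) <= e.
    move=> Nm' Nn' mn; apply: le_trans (root_iter_dist _ mn) _.
    have := qN _ _ Nm' Nn'; rewrite ler_pdivlMr//; apply: le_trans.
    by rewrite ler_wpM2l ?lerDl// subr_ge0 scalar_iter_le.
  have [mn|/ltnW nm] := leqP m n; first by rewrite hnormC key.
  exact: key.
have Y'1 x : hnorm (Y' x) <= hnorm x by exact: hcvg_hnorm_le (YY' x) _.
have bY' : bounded_op Y'.
  apply/bounded_opP; split=> [a x y|]; last by exists 1 => // x; rewrite mul1r.
  apply: hcvg_unique (YY' _) _.
  have := hcvgD (hcvgZ a (YY' x)) (YY' y); congr (hcvg _ _).
  by apply/funext => n; rewrite (bY n).1.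
exists Y'; split=> // [x y|x].
  apply: (hcvg_inner_eq (YY' x) (YY' y)) => n.
  elim: n x y => [|n IH] x y; first by rewrite inner0l inner0r.
  by rewrite /= innerZl innerZr conj_real innerDl innerDr symK !IH.
apply: hcvg_unique (hcvg_shift (YY' x)) _ => /=; apply: hcvgZ.
apply: hcvgD; first exact: hcvg_cst.
move=> e e0; have e2 : 0 < e / 2 by rewrite divr_gt0.
have [[M YM] [N YN]] := (YY' x _ e2, YY' (Y' x) _ e2); exists (maxn M N) => n.
rewrite geq_max => /andP[/YM Mn /YN Nn].
apply: le_trans (hdist_tri (Y n (Y' x)) _ _) _.
have := Y1 n (Y n x - Y' x); rewrite (bounded_opB _ _ (bY n)).
by move: Mn Nn; lra.
Qed.

End contraction_root.

Lemma psd_bounded_scale T (r : R) : psd T -> 0 <= r ->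
  psd (fun x => r%:C *: T x).
Proof.
move=> [bT T0] r0; split; first exact: bounded_op_scale.
by move=> x; rewrite innerZl mulr_ge0// lecR.
Qed.

Lemma psd_sqrt_contraction T : psd T -> (forall x, hnorm (T x) <= hnorm x) ->
  exists2 S, psd S & forall x, S (S x) = T x.
Proof.
move=> pT T1; have [bT T0] := pT.
have T0' x : 0 <= complex.Re (inner (T x) x).
  by have := T0 x; rewrite lecE => /andP[].
have [||x|Y [bY Y1 symY YE]] := @contraction_root_ex (fun x => x - T x).
- by apply: bounded_op_sub => //; exact: bounded_op_id.
(* 1 - T is a contraction: |x - T x|^2 = |x|^2 + |T x|^2 - 2 <T x, x>, where |T x|^2 <= <T x, x>. *)
- move=> x; rewrite -ler_sqr ?nnegrE// hnormB_sqr.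
  rewrite innerC Re_conj.
  by have := psd_contraction_sqr x pT T1; have := T0' x; lra.
- by move=> y; rewrite innerBl innerBr psd_selfadjoint.
have bS : bounded_op (fun x => x - Y x).
  by apply: bounded_op_sub => //; exact: bounded_op_id.
exists (fun x => x - Y x) => [|x].
  split=> // x; rewrite innerBl innerxx.
  have rY : inner (Y x) x = (complex.Re (inner (Y x) x))%:C.
    by rewrite RRe_real//; apply/CrealP; rewrite -innerC symY.
  rewrite rY -rmorphB/= lecR subr_ge0; apply: le_trans (ler_Re_cnorm _) _.
  apply: le_trans (cauchy_schwarz _ _) _; by rewrite expr2 ler_wpM2r.
rewrite bounded_opB//.
have : (2 : R)%:C *: Y x = x - T x + Y (Y x).
  by rewrite {1}YE scalerA -rmorphM/= divff// scale1r.
rewrite raddfD/= scalerDl scale1r => h.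
rewrite opprB addrA addrAC -[x - Y x - Y x]addrA -opprD h.
by rewrite opprD opprB -addrA subrK addrC subrK.
Qed.

Lemma psd_sqrt T : psd T -> exists2 S, psd S & forall x, S (S x) = T x.
Proof.
move=> pT; have [bT T0] := pT; have /bounded_opP[_ [c c0 Tc]] := bT.
have c1 : 0 < c + 1 by rewrite ltr_wpDl.
(* The bound c may be zero, whereas dividing by c + 1 always turns [T] into a contraction. *)
have [||S pS SE] := @psd_sqrt_contraction (fun x => (c + 1)^-1%:C *: T x).
- by apply: psd_bounded_scale => //; rewrite invr_ge0 ltW.
- move=> x; rewrite hnormZr ger0_norm ?invr_ge0 ?(ltW c1)//.
  rewrite mulrC ler_pdivrMr// mulrC; apply: le_trans (Tc _) _.
  by rewrite ler_wpM2r// lerDl.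
exists (fun x => (Num.sqrt (c + 1))%:C *: S x).
  by apply: psd_bounded_scale => //; exact: sqrtr_ge0.
move=> x; rewrite bounded_opZ; last exact: pS.1.
rewrite SE !scalerA -!rmorphM/= -expr2 sqr_sqrtr ?(ltW c1)//.
by rewrite divff ?scale1r// gt_eqF.
Qed.

Lemma sqrt_opP T : psd T ->
  psd (sqrt_op T) /\ forall x, sqrt_op T (sqrt_op T x) = T x.
Proof.
move=> pT; rewrite /sqrt_op; case: xgetP => [S _ [pS <-] //|nS].
by have [S pS SE] := psd_sqrt pT; case: (nS S); split => //; exact/funext.
Qed.

Lemma hnorm_sqrt_op T x : psd T ->
  hnorm (sqrt_op T x) ^+ 2 = complex.Re (inner (T x) x).
Proof. by move=> pT; have [pS SE] := sqrt_opP pT;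
  rewrite psd_inner_sqr// SE. Qed.

Lemma psd_gram T : bounded_op T -> psd (adjoint T \o T).
Proof.
move=> bT; have [bA AE] := adjointP bT.
split; first exact: bounded_op_comp.
by move=> x /=; rewrite inner_adjointl// innerxx lecR sqr_ge0.
Qed.

Lemma abs_opP T : bounded_op T -> [/\ psd (abs_op T),
  forall x, abs_op T (abs_op T x) = adjoint T (T x) &
  forall x, hnorm (abs_op T x) = hnorm (T x)].
Proof.
move=> bT; have pT := psd_gram bT; have [pS SE] := sqrt_opP pT.
split=> // x; apply/eqP; rewrite -(@eqrXn2 _ 2)//; apply/eqP.
by rewrite hnorm_sqrt_op//= inner_adjointl// innerxx.
Qed.

End square_root.

(** * Uniform boundedness and Douglas' lemma *)

Section uniform_boundedness.
Context {R : realType} {H : hilbertType R}.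
Implicit Types (x y z w : H) (G K T X : H -> H) (M F : set H).

Section gliding_hump.
Variable w : nat -> H.
Hypothesis w0 : forall n, 0 < hnorm (w n).

Let r n : R := 4^-1 ^+ n.

(* The n-th summand is kept only when it is needed to make <x, w n> large, and
   the later ones are too small to undo this. *)
Fixpoint hump n : H :=
  if n is m.+1 then
    if r m * hnorm (w m) / 2 <= cnorm (inner (hump m) (w m)) then hump m
    else hump m + (r m / hnorm (w m))%:C *: w m
  else 0.

Let r0 n : 0 < r n. Proof. by rewrite exprn_gt0// invr_gt0. Qed.

Let rS n : r n.+1 = r n / 4. Proof. by rewrite /r exprSr. Qed.

(** If the test fails, the old product is below half of [r n * hnorm (w n)] while the new term
    contributes the whole of it, so more than half remains. *)
Lemma hump_inner n : r n * hnorm (w n) / 2 <= cnorm (inner (hump n.+1) (w n)).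
Proof.
rewrite /=; case: ifPn => //; rewrite -ltNge => h.
rewrite innerDl innerZl innerxx -rmorphM/=.
have -> : r n / hnorm (w n) * hnorm (w n) ^+ 2 = r n * hnorm (w n).
  by rewrite expr2 mulrA divfK// gt_eqF.
set b := _%:C.
have := cnormD (inner (hump n) (w n) + b) (- inner (hump n) (w n)).
have -> : inner (hump n) (w n) + b - inner (hump n) (w n) = b by ring.
rewrite cnormN /b cnorm_real gtr0_norm ?mulr_gt0//; move: h; lra.
Qed.

Lemma hump_step n : hnorm (hump n.+1 - hump n) <= r n.
Proof.
rewrite /=; case: ifPn => _; first by rewrite subrr hnorm0 ltW.
rewrite addrC addKr hnormZr gtr0_norm ?divr_gt0// divfK// gt_eqF//.
Qed.

Lemma hump_dist m n : (n <= m)%N ->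
  hnorm (hump m - hump n) <= 4 / 3 * (r n - r m).
Proof.
elim: m => [|m IH]; first by rewrite leqn0 => /eqP ->;
  rewrite !subrr hnorm0 mulr0.
rewrite leq_eqVlt => /predU1P[->|]; first by rewrite !subrr hnorm0 mulr0.
rewrite ltnS => /IH h; apply: le_trans (hdist_tri (hump m) _ _) _.
by have := hump_step m; rewrite rS; move: h; lra.
Qed.

Lemma hump_cvg : exists x, forall n,
  r n * hnorm (w n) / 6 <= cnorm (inner x (w n)).
Proof.
have r_small n : r n <= n.+1%:R^-1.
  rewrite /r exprVn lef_pV2 ?posrE// ?exprn_gt0// -natrX ler_nat.
  exact: ltn_expl.
have [x hx] : exists x, hcvg hump x.
  apply: hcauchy_hcvg => e e0.
  have [|N NP] := @exists_invn_le _ (e / (4 / 3)); first by rewrite divr_gt0.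
  exists N => m n Nm Nn.
  have key i j : (N <= i)%N -> (i <= j)%N -> hnorm (hump j - hump i) <= e.
    move=> Ni ij; apply: le_trans (hump_dist ij) _.
    have : 4 / 3 * r i <= e.
      apply: le_trans (_ : 4 / 3 * i.+1%:R^-1 <= _).
        by rewrite ler_wpM2l// r_small.
      by rewrite mulrC -ler_pdivlMr// NP.
    by have := r0 j; lra.
  have [mn|/ltnW nm] := leqP m n; first by rewrite hnormC key.
  exact: key.
exists x => n.
(* The steps from rank n + 1 on add up to at most 4/3 r_(n+1) = r_n / 3, which leaves 1/2 - 1/3 =
   1/6 of [r n * hnorm (w n)]. *)
have xn : hnorm (x - hump n.+1) <= r n / 3.
  apply/ler_addgt0Pr => e e0; have [N hN] := hx _ e0.
  have := hN _ (leq_maxl N n.+1); have := hump_dist (leq_maxr N n.+1).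
  set m := maxn N n.+1; have := r0 m; rewrite rS.
  by have := hdist_tri (hump m) x (hump n.+1); rewrite (hnormC x (hump m)); lra.
have := cnormD (inner x (w n)) (- inner (x - hump n.+1) (w n)).
rewrite cnormN innerBl opprB addrC subrK.
have := cauchy_schwarz (x - hump n.+1) (w n); rewrite innerBl.
have : hnorm (x - hump n.+1) * hnorm (w n) <= r n / 3 * hnorm (w n).
  by rewrite ler_wpM2r.
have := hump_inner n; set a := cnorm _; set b := cnorm _; set c := cnorm _.
lra.
Qed.

End gliding_hump.

(** The uniform boundedness principle, each vector y standing for the functional <., y> up to
    conjugation. *)
Lemma weakly_bounded F :
  (forall x, exists c : R, forall y, F y -> cnorm (inner x y) <= c) ->
  exists2 c : R, 0 <= c & forall y, F y -> hnorm y <= c.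
Proof.
move=> wF; apply: contrapT => nF.
(* The rate 8^n beats the weights 4^-n of the humps: the products with the limit then exceed 2^n /
   6. *)
have /choice[w wP] (n : nat) : exists y, F y /\ 8 ^+ n < hnorm y.
  apply: contrapT => nw; apply: nF; exists (8 ^+ n); first exact: exprn_ge0.
  by move=> y Fy; rewrite leNgt; apply/negP => ny; apply: nw; exists y.
have w0 n : 0 < hnorm (w n) by apply: lt_trans (wP n).2; rewrite exprn_gt0.
have [x xP] := hump_cvg w0; have [c xc] := wF x.
pose n := Num.truncn (6 * c).
have := le_trans (xP n) (xc _ (wP n).1).
have : 6 * c < n.+1%:R by exact: truncnS_gt.
have : n.+1%:R <= 2 ^+ n :> R by rewrite -natrX ler_nat ltn_expl.
have -> : 2 ^+ n = 4^-1 ^+ n * 8 ^+ n :> R.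
  by rewrite -exprMn; congr (_ ^+ _); field.
have : 4^-1 ^+ n * 8 ^+ n <= 4^-1 ^+ n * hnorm (w n).
  by rewrite ler_wpM2l ?exprn_ge0 ?invr_ge0// ltW// (wP n).2.
lra.
Qed.

Definition hclosure M : set H :=
  [set x | forall e : R, 0 < e -> exists2 y, M y & hnorm (x - y) < e].

Lemma hclosed_hclosure M : hclosed (hclosure M).
Proof.
move=> x xM e e0; have e2 : 0 < e / 2 by rewrite divr_gt0.
have [y /(_ _ e2)[z Mz yz] xy] := xM _ e2; exists z => //.
by have := hdist_tri y x z; move: xy yz; lra.
Qed.

Lemma sub_hclosure M x : M x -> hclosure M x.
Proof. by move=> Mx e e0; exists x => //; rewrite subrr hnorm0. Qed.

Lemma subspace_hclosure M : subspace M -> subspace (hclosure M).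
Proof.
move=> sM; split; first exact: sub_hclosure sM.1.
move=> a x y xM yM e e0; have e2 : 0 < e / 2 by rewrite divr_gt0.
have c0 : 0 < cnorm a + 1 by rewrite ltr_wpDl.
have [[x' Mx xx] [y' My yy]] := (xM _ (divr_gt0 e2 c0), yM _ e2).
exists (a *: x' + y'); first exact: sM.2.
rewrite opprD addrACA -scalerBr; apply: le_lt_trans (hnormD _ _) _.
rewrite hnormZ; move: xx; rewrite ltr_pdivlMr// mulrDr mulr1 mulrC.
by have := hnorm_ge0 (x - x'); move: yy; lra.
Qed.

(* The bound comes from the inequality |K^* z| <= c |G^* z|, itself an instance
   of the uniform boundedness principle since <x, K^* z> = <X x, G^* z>. *)
Lemma douglas G K : bounded_op G -> bounded_op K -> range K `<=` range G ->
  exists X, [/\ bounded_op X, forall x, G (X x) = K x &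
                forall x, orthc (nullspace G) (X x)].
Proof.
move=> bG bK KG; pose N := nullspace G.
have sN : subspace N.
  split; first exact: bounded_op0.
  move=> a x y; rewrite /N /nullspace/= => x0 y0.
  by rewrite bG.1 x0 y0 scaler0 addr0.
have [bA GA] := adjointP bG; have [bKA KA] := adjointP bK.
have orthN x : orthc (range (adjoint G)) x -> N x.
  move=> xG; apply: inner_ext => z; rewrite inner0l GA; apply: xG; by exists z.
have cN : hclosed N.
  move=> x xN; apply: orthN => _ [z _ <-]; apply: inner_small => e /xN[y Ny xy].
  by exists y => //; rewrite -GA Ny inner0l.
(* A preimage orthogonal to [N] is unique, which makes the chosen function linear. *)
have /choice[X XP] x : exists y, G y = K x /\ orthc N y.
  have [z _ Gz] : range G (K x) by apply: KG; exists x.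
  have [Np zN] := projP z sN cN; exists (z - proj N z); split => //.
  by rewrite bounded_opB// Np subr0.
have N_inj x : N x -> orthc N x -> x = 0.
  by move=> Nx xN; apply/innerxx_eq0/xN.
have lX : linear X.
  move=> a x y; apply/subr0_eq/N_inj.
    rewrite /N/= /nullspace/= bounded_opB// bG.1 !(XP _).1.
    by rewrite bK.1 subrr.
  apply: (subspaceB (subspace_orthc N)); first exact: (XP _).2.
  by apply (subspace_orthc N).2; exact: (XP _).2.
have innerX x z : inner (X x) (adjoint G z) = inner x (adjoint K z).
  by rewrite -GA (XP x).1 KA.
have [|c c0 Fc] := @weakly_bounded
    [set adjoint K z | z in [set z | hnorm (adjoint G z) <= 1]].
  move=> x; exists (hnorm (X x)) => _ [z /= z1 <-]; rewrite -innerX.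
  by apply: le_trans (cauchy_schwarz _ _) _; rewrite ler_piMr.
(* Rescaling by a strict bound [d] also covers the case where [adjoint G z] is zero. *)
have Kc z (d : R) : hnorm (adjoint G z) < d -> hnorm (adjoint K z) <= c * d.
  move=> zd; have d0 : 0 < d by exact: le_lt_trans zd.
  have := Fc (adjoint K ((d^-1)%:C *: z)).
  rewrite (bounded_opZ _ _ bKA) hnormZr gtr0_norm ?invr_gt0//.
  rewrite mulrC ler_pdivrMr//; apply; exists (d^-1%:C *: z); last first.
    by rewrite bounded_opZ.
  rewrite /= bounded_opZ// hnormZr gtr0_norm ?invr_gt0// mulrC.
  by rewrite ler_pdivrMr// mul1r ltW.
have dense_range x : orthc N x -> hclosure (range (adjoint G)) x.
  move=> Nx; have sG := subspace_hclosure (subspace_range bA).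
  have [Mp xp] := projP x sG (@hclosed_hclosure _).
  set y := proj _ x in Mp xp; have -> : x = y; last by [].
  have Nxy : N (x - y).
    by apply: orthN => z Gz; apply: xp; exact: sub_hclosure.
  by apply/subr0_eq/innerxx_eq0;
    rewrite innerBr (inner_eq0C (Nx _ Nxy)) xp// subr0.
exists X; split; [|by move=> x; exact: (XP x).1|by move=> x; exact: (XP x).2].
apply/bounded_opP; split=> //; exists c => // x.
have [->|X0] := eqVneq (X x) 0; first by rewrite hnorm0 mulr_ge0.
rewrite -(ler_pM2l (hnorm_gt0 X0)); apply/ler_addgt0Pr => e e0.
(* With G^* z within t = e / D of [X x], one has |G^* z| < k + 2 t, and k^2 is at most k c |x| plus
   an error t (2 c |x| + k), itself at most D t = e. The 1 keeps [D] positive. *)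
set k := hnorm (X x); pose D := 2 * c * hnorm x + k + 1.
have k0 : 0 <= k by exact: hnorm_ge0.
have D0 : 0 < D by rewrite /D; have := mulr_ge0 c0 (hnorm_ge0 x); lra.
have eD : 0 < e / D by rewrite divr_gt0.
have [_ [z _ <-] Xz] := dense_range _ (XP x).2 _ eD.
have h1 : hnorm (adjoint G z) < k + 2 * (e / D).
  have := hdist_tri (X x) (adjoint G z) 0; rewrite !subr0 hnormC -/k.
  by move: Xz eD; move: (e / D) => t; lra.
have h2 : cnorm (inner x (adjoint K z)) <= hnorm x * (c * (k + 2 * (e / D))).
  by apply: le_trans (cauchy_schwarz _ _) _; rewrite ler_wpM2l// Kc.
have h3 : k * k <= hnorm x * (c * (k + 2 * (e / D))) + k * (e / D).
  have -> : k * k = cnorm (inner (X x) (X x)).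
    by rewrite innerxx cnorm_real ger0_norm ?sqr_ge0.
  rewrite -{2}[X x](subrK (adjoint G z)) innerDr innerX addrC.
  apply: le_trans (cnormD _ _) _; rewrite lerD//.
  by apply: le_trans (cauchy_schwarz _ _) _; rewrite ler_wpM2l// ltW.
apply: le_trans h3 _.
have -> : k * (c * hnorm x) + e = k * (c * hnorm x) + D * (e / D).
  by rewrite [D * _]mulrC divfK// gt_eqF.
by move: eD; rewrite /D; move: (e / D) => t; nra.
Qed.

End uniform_boundedness.

(** * Eigenvectors of |T| *)

Section singular_values.
Context {R : realType} {H : hilbertType R}.
Implicit Types (x y z : H) (P Q T : H -> H) (M : set H) (s : seq H).

(* This weak form of compactness is stable under composition on the right with
   a bounded operator. *)
Definition clusters_on_ball T := forall u : nat -> H,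
  (forall n, hnorm (u n) <= 1) -> exists y, forall (e : R) N, 0 < e ->
    exists2 n, (N <= n)%N & hnorm (T (u n) - y) < e.

Lemma clusters_on_ball_comp T X : clusters_on_ball T -> bounded_op T ->
  bounded_op X -> clusters_on_ball (T \o X).
Proof.
move=> cT bT bX u u1; have /bounded_opP[_ [c c0 Xc]] := bX.
have c1 : 0 < c + 1 by rewrite ltr_wpDl.
have [|y yP] := cT (fun n => (c + 1)^-1%:C *: X (u n)).
  move=> n; rewrite hnormZr gtr0_norm ?invr_gt0// mulrC ler_pdivrMr// mul1r.
  apply: le_trans (Xc _) _; have := u1 n; have := hnorm_ge0 (u n); nra.
exists ((c + 1)%:C *: y) => e N e0.
have [n Nn h] := yP _ N (divr_gt0 e0 c1); exists n => //=.
have -> : T (X (u n)) = (c + 1)%:C *: T ((c + 1)^-1%:C *: X (u n)).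
  by rewrite (bounded_opZ _ _ bT) scalerA -rmorphM/= divff ?scale1r// gt_eqF.
rewrite -scalerBr hnormZr gtr0_norm//.
by move: h; rewrite ltr_pdivlMr// mulrC.
Qed.

Section eigenvector.
Variables (T : H -> H) (M : set H) (x0 : H) (l : R).
Hypothesis bT : bounded_op T.
Hypothesis cT : clusters_on_ball T.
Hypothesis sM : subspace M.
Hypothesis cM : hclosed M.
Let Q := abs_op T.
Hypothesis QM : forall x, M x -> M (Q x).
Hypothesis Mx0 : M x0.
Hypothesis x0_neq0 : x0 != 0.
Hypothesis l0 : 0 < l.
Hypothesis lT : l * hnorm x0 <= hnorm (T x0).

Let D := [set hnorm (T x) | x in [set x | M x /\ hnorm x = 1]].
Let c := sup D.

Lemma hnorm_normalize x : x != 0 -> hnorm ((hnorm x)^-1%:C *: x) = 1.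
Proof.
move=> n0; have n := hnorm_gt0 n0.
by rewrite hnormZr gtr0_norm ?invr_gt0// mulVf// gt_eqF.
Qed.

Lemma restricted_norm_has_sup : has_sup D.
Proof.
split.
  exists (hnorm (T ((hnorm x0)^-1%:C *: x0))), ((hnorm x0)^-1%:C *: x0) => //.
  by split; [exact: subspaceZ | exact: hnorm_normalize].
have /bounded_opP[_ [a a0 Ta]] := bT.
by exists a => _ [x [_ x1] <-]; have := Ta x; rewrite x1 mulr1.
Qed.

Lemma restricted_norm_le x : M x -> hnorm (T x) <= c * hnorm x.
Proof.
move=> Mx; have [->|n0] := eqVneq x 0;
  first by rewrite bounded_op0// hnorm0 mulr0.
rewrite -ler_pdivrMr ?hnorm_gt0//;
  apply: ub_le_sup restricted_norm_has_sup.2 _ _.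
exists ((hnorm x)^-1%:C *: x).
  by split; [exact: subspaceZ | exact: hnorm_normalize].
by rewrite bounded_opZ// hnormZr gtr0_norm ?invr_gt0 ?hnorm_gt0// mulrC.
Qed.

Lemma restricted_norm_ge : l <= c.
Proof.
rewrite -(ler_pM2r (hnorm_gt0 x0_neq0)); apply: le_trans lT _.
exact: restricted_norm_le.
Qed.

(** For a unit vector, |Q^2 x - c^2 x|^2 = |Q^2 x|^2 - 2 c^2 |Q x|^2 + c^4. Invariance of [M] gives
    |Q^2 x| <= c |Q x|, which leaves c^2 (c^2 - |Q x|^2), small because |Q x| > c - e. *)
Lemma almost_eigenvector x (e : R) : 0 <= c -> M x -> hnorm x = 1 ->
  c - e < hnorm (T x) ->
  hnorm (Q (Q x) - (c ^+ 2)%:C *: x) ^+ 2 <= 2 * c ^+ 3 * e.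
Proof.
move=> c0 Mx x1 xe; have [pQ QQ QT] := abs_opP bT.
have /= := restricted_norm_le (QM Mx); rewrite -QT -/Q => h1.
have h2 : hnorm (Q x) <= c by rewrite QT; have := restricted_norm_le Mx;
  rewrite x1 mulr1.
rewrite hnormB_sqr innerZr conj_real (psd_selfadjoint _ _ pQ) innerxx.
rewrite -rmorphM/= hnormZr x1 mulr1 ger0_norm ?sqr_ge0//.
have h3 : hnorm (Q (Q x)) ^+ 2 <= (c * hnorm (Q x)) ^+ 2.
  by rewrite ler_sqr ?nnegrE// mulr_ge0.
have h4 : c ^+ 2 - 2 * c * e <= hnorm (Q x) ^+ 2.
  move: xe; rewrite -QT -/Q => xe.
  have [ce|/ltW ec] := leP e c; first by nra.
  have := sqr_ge0 (hnorm (Q x)); nra.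
have h5 : c ^+ 2 * (c ^+ 2 - 2 * c * e) <= c ^+ 2 * hnorm (Q x) ^+ 2.
  by rewrite ler_wpM2l ?sqr_ge0.
move: h3 h5; rewrite exprMn;
  move: (hnorm (Q (Q x)) ^+ 2) (hnorm (Q x) ^+ 2) => a b.
by nra.
Qed.

(* With c the norm of T on M, a maximizing sequence u satisfies
   Q (Q u) - c^2 u -> 0, and Q (Q u) = T^* T u clusters; at a nonzero vector v with
   Q (Q v) = c^2 v, the vector Q v + c v is an eigenvector of Q. *)
Lemma eigenvector_in_subspace :
  exists k z, [/\ l <= k, M z, hnorm z = 1 & Q z = k%:C *: z].
Proof.
have [pQ QQ QT] : [/\ psd Q, forall x, Q (Q x) = adjoint T (T x) &
  forall x, hnorm (Q x) = hnorm (T x)] := abs_opP bT.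
have bQ := pQ.1.
have lc := restricted_norm_ge; have c0 : 0 < c by exact: lt_le_trans lc.
have /choice[u uP] (n : nat) : exists x, [/\ M x, hnorm x = 1 &
    c - n.+1%:R^-1 < hnorm (T x)].
  have n0 : 0 < n.+1%:R^-1 :> R by rewrite invr_gt0.
  by have [_ [x [Mx x1] <-] xn] := sup_adherent n0 restricted_norm_has_sup;
    exists x.
have [|y yP] := @cT u; first by move=> n; have [_ -> _] := uP n.
have [bA TA] := adjointP bT; have /bounded_opP[_ [a a0 Aa]] := bA.
(* When T u_n is near y, the vector c^2 u_n, close to Q (Q u_n) = T^* T u_n, is near T^* y. *)
pose v := (c ^- 2)%:C *: adjoint T y.
have approx (d : R) : 0 < d -> exists x, [/\ M x, hnorm x = 1,
    hnorm (x - v) <= d & hnorm (Q (Q x) - (c ^+ 2)%:C *: x) <= d].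
  move=> d0.
  (* The distance c^2 |x - v| is split into two halves of c^2 d: the residual, at most [d1], and
     |T^* (T x - y)|, controlled by [e2]. The value [e1] solves 2 c^3 e1 = d1^2, as
     [almost_eigenvector] requires. *)
  pose d1 := Num.min d (c ^+ 2 * d / 2).
  have d10 : 0 < d1 by rewrite lt_min d0 divr_gt0// mulr_gt0// exprn_gt0.
  pose e1 := d1 ^+ 2 / (2 * c ^+ 3).
  have e10 : 0 < e1 by rewrite divr_gt0 ?exprn_gt0// mulr_gt0// exprn_gt0.
  pose e2 := (c ^+ 2 * d / 2) / (a + 1).
  have a1 : 0 < a + 1 by rewrite ltr_wpDl.
  have e20 : 0 < e2 by rewrite divr_gt0// divr_gt0// mulr_gt0// exprn_gt0.
  have [N /(_ _ _)ne] := exists_invn_le e10.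
  have [n /ne{}ne yn] := yP e2 N e20.
  have [Mx x1 xn] := uP n; exists (u n).
  have h : hnorm (Q (Q (u n)) - (c ^+ 2)%:C *: u n) <= d1.
    rewrite -ler_sqr ?nnegrE//; last exact: ltW.
    apply: le_trans (almost_eigenvector (ltW c0) Mx x1 (e := e1) _) _.
      by apply: le_lt_trans xn; rewrite lerD2l lerN2.
    by rewrite /e1 mulrC divfK// gt_eqF// mulr_gt0// exprn_gt0.
  split => //; last by apply: le_trans h _; rewrite ge_min lexx.
  have -> : u n - v = (c ^- 2)%:C *: ((c ^+ 2)%:C *: u n - adjoint T y).
    rewrite scalerBr scalerA -rmorphM/= mulVf ?scale1r// gt_eqF// exprn_gt0//.
  rewrite hnormZr gtr0_norm ?invr_gt0 ?exprn_gt0// mulrC ler_pdivrMr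
    ?exprn_gt0//.
  apply: le_trans (hdist_tri (Q (Q (u n))) _ _) _; rewrite [d * _]mulrC hnormC.
  have h' : d1 <= c ^+ 2 * d / 2 by rewrite ge_min lexx orbT.
  have h2 : hnorm (Q (Q (u n)) - adjoint T y) <= c ^+ 2 * d / 2.
    rewrite QQ -bounded_opB//; apply: le_trans (Aa _) _.
    move: yn; rewrite /e2 ltr_pdivlMr// mulrDr mulr1 mulrC => yn.
    by have := hnorm_ge0 (T (u n) - y); move: yn; lra.
  by move: h h' h2; lra.
have /choice[w wP] (n : nat) := approx n.+1%:R^-1 (ltac:(by rewrite invr_gt0)).
have wv : hcvg w v.
  move=> e /exists_invn_le[N NP]; exists N => n /NP; apply: le_trans.
  by have [] := wP n.
have Mv : M v by apply: hclosed_hcvg wv => // n; have [] := wP n.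
(* Some unit vector lies within 1/2 of [v]. *)
have v0 : v != 0.
  apply/eqP => v0; have := approx 2^-1 (ltac:(by rewrite invr_gt0)).
  by move=> [x [_ x1 + _]]; rewrite v0 subr0 x1; lra.
have diff0 : hcvg (fun n => Q (Q (w n)) - (c ^+ 2)%:C *: w n) 0.
  move=> e /exists_invn_le[N NP]; exists N => n /NP; rewrite subr0;
    apply: le_trans.
  by have [] := wP n.
have QQv : Q (Q v) = (c ^+ 2)%:C *: v.
  apply: hcvg_unique (bounded_op_hcvg bQ (bounded_op_hcvg bQ wv)) _.
  have := hcvgD diff0 (hcvgZ (c ^+ 2)%:C wv); rewrite add0r.
  by congr (hcvg _ _); apply/funext => n; exact: subrK.
pose z := Q v + c%:C *: v.
have Qz : Q z = c%:C *: z.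
  rewrite /z (bounded_opD _ _ bQ) (bounded_opZ c%:C v bQ) QQv scalerDr scalerA
    -rmorphM/=.
  by rewrite -expr2 addrC.
have Mz : M z by apply: subspaceD => //; [exact: QM | exact: subspaceZ].
have z0 : z != 0.
  apply/eqP => /eqP; rewrite addr_eq0 => /eqP Qv.
  have := pQ.2 v; rewrite Qv innerNl innerZl innerxx -rmorphM/= oppr_ge0 lecR.
  by rewrite leNgt mulr_gt0// exprn_gt0// hnorm_gt0.
exists c, ((hnorm z)^-1%:C *: z); split=> //.
- exact: subspaceZ.
- exact: hnorm_normalize.
- by rewrite (bounded_opZ _ _ bQ) Qz !scalerA mulrC.
Qed.

End eigenvector.

End singular_values.

(** * Monotonicity of Schatten norms *)

Section schatten_monotone.
Context {R : realType} {H : hilbertType R}.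
Implicit Types (x y : H) (P Q T : H -> H) (M : set H) (s : seq H).
Implicit Types (t : seq (R * H)).

(** * Orthonormal families and dimension *)

Definition orthonormal_seq s := uniq s /\
  forall x y, x \in s -> y \in s -> inner x y = (x == y)%:R.

Lemma orthonormal_nth s (i j : 'I_(size s)) : orthonormal_seq s ->
  inner (nth 0 s i) (nth 0 s j) = (i == j)%:R.
Proof.
by move=> [us os]; rewrite os ?mem_nth// nth_uniq.
Qed.

Lemma orthonormal_cat s1 s2 : orthonormal_seq s1 -> orthonormal_seq s2 ->
  (forall x y, x \in s1 -> y \in s2 -> inner x y = 0) ->
  orthonormal_seq (s1 ++ s2).
Proof.
move=> [u1 o1] [u2 o2] o12.
have disj x : x \in s1 -> x \in s2 -> False.
  move=> x1 x2; have := o1 _ _ x1 x1; rewrite (o12 _ _ x1 x2) eqxx => /esym/eqP.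
  by rewrite oner_eq0.
split.
  rewrite cat_uniq u1 u2 andbT/=; apply/hasPn => x x2; apply/negP => x1.
  exact: disj x1 x2.
move=> x y; rewrite !mem_cat => /orP[x1|x2] /orP[y1|y2];
  [exact: o1| | |exact: o2].
  rewrite o12//; case: eqP => // xy; rewrite -xy in y2; by have := disj _ x1 y2.
rewrite inner_eq0C ?o12//; case: eqP => // xy; rewrite -xy in y1; by have :=
  disj _ y1 x2.
Qed.

Lemma orthonormal1 x : hnorm x = 1 -> orthonormal_seq [:: x].
Proof.
move=> x1; split=> // y z; rewrite !inE => /eqP -> /eqP ->.
by rewrite innerxx x1 eqxx expr1n.
Qed.

Lemma orthonormal_comb_inner n (e : 'I_n -> H) (c : 'I_n -> R[i]) i :
  (forall i j, inner (e i) (e j) = (i == j)%:R) ->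
  inner (\sum_j c j *: e j) (e i) = c i.
Proof.
move=> oe; rewrite inner_suml (bigD1 i)//= innerZl oe eqxx mulr1 big1 ?addr0//.
by move=> j ji; rewrite innerZl oe (negPf ji) mulr0.
Qed.

Lemma orthonormal_comb_norm n (e : 'I_n -> H) (c : 'I_n -> R[i]) :
  (forall i j, inner (e i) (e j) = (i == j)%:R) ->
  hnorm (\sum_i c i *: e i) ^+ 2 = \sum_i cnorm (c i) ^+ 2.
Proof.
move=> oe; apply: complexI; rewrite -innerxx {1}inner_suml rmorph_sum/=.
apply: eq_bigr => i _; rewrite innerZl innerC orthonormal_comb_inner//.
by rewrite cnorm_sqr.
Qed.

(** There are fewer conditions than coefficients: the matrix of inner products has more rows than
    columns, so its left kernel contains a nonzero row. *)
Lemma orthogonal_combination n (e : 'I_n -> H) s : (size s < n)%N ->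
  exists c : 'I_n -> R[i], (exists i, c i != 0) /\
    forall y, y \in s -> inner (\sum_i c i *: e i) y = 0.
Proof.
move=> sn; pose A : 'M[R[i]]_(n, size s) :=
  \matrix_(i, j) inner (e i) (nth 0 s j).
have : kermx A != 0.
  by rewrite -mxrank_eq0 mxrank_ker -lt0n subn_gt0 (leq_ltn_trans (rank_leq_col
    A)).
move=> /rowV0Pn[v /sub_kermxP vA v0]; exists (v 0); split.
  by move/rV0Pn : v0 => [i vi]; exists i.
move=> y /(nthP 0)[j js <-]; rewrite inner_suml.
move/matrixP/(_ 0 (Ordinal js)) : vA; rewrite !mxE => vA; rewrite -[RHS]vA.
by apply: eq_bigr => i _; rewrite innerZl mxE.
Qed.

(** Each new vector is a combination of all the [e i], orthogonal to the fewer than n vectors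
    already built; independence makes it nonzero. *)
Lemma gram_schmidt M n (e : 'I_n -> H) : subspace M -> lin_indep e ->
  (forall i, M (e i)) ->
  exists s, [/\ orthonormal_seq s, size s = n & forall x, x \in s -> M x].
Proof.
move=> sM le Me.
have: (n <= n)%N by [].
elim: {1 3}n => [|k IH] kn; first by exists [::].
have [s [os ks Ms]] := IH (ltnW kn).
have [|c [[i ci] cs]] := @orthogonal_combination n e s; first by rewrite ks.
set x := \sum_i _ in cs.
have x0 : x != 0.
  by apply: contra_neq ci => /le->.
have Mx : M x.
  rewrite /x; apply: (big_ind M) => [|y z|j _]; first exact: sM.1.
    exact: subspaceD.
  exact: subspaceZ.
exists (((hnorm x)^-1%:C *: x) :: s); split.
- rewrite -cat1s; apply: orthonormal_cat => //.
    by apply: orthonormal1; exact: hnorm_normalize.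
  by move=> y z; rewrite inE => /eqP -> zs; rewrite innerZl cs// mulr0.
- by rewrite /= ks.
- by move=> y; rewrite inE => /predU1P[->|/Ms//]; exact: subspaceZ.
Qed.

Lemma orthonormal_dimension M s : orthonormal_seq s ->
  (forall x, x \in s -> M x) ->
  ((size s)%:R%:E <= dimension M)%E.
Proof.
move=> os Ms; apply: ereal_sup_ubound; exists (size s) => //.
exists (fun i : 'I_(size s) => nth 0 s i); split; last first.
  by move=> i; apply/Ms/mem_nth.
move=> c c0 i.
rewrite -(@orthonormal_comb_inner _ (fun i : 'I_(size s) => nth 0 s i) c i).
  by rewrite c0 inner0l.
by move=> ? ?; exact: orthonormal_nth.
Qed.

(** The supremum that defines [dimension] is either infinite or attained, and in both cases
    independent families can be replaced by orthonormal ones. *)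
Lemma dimension_orthonormal M : subspace M ->
  (forall n, exists s, [/\ orthonormal_seq s, (n <= size s)%N &
     forall x, x \in s -> M x]) \/
  (exists s, [/\ orthonormal_seq s, forall x, x \in s -> M x &
     dimension M = (size s)%:R%:E]).
Proof.
move=> sM; pose D n := exists e : 'I_n -> H, lin_indep e /\ forall i, M (e i).
have [unb|/existsNP[N NP]] := pselect (forall n, exists2 m, (n <= m)%N & D m).
  left=> n; have [m nm [e [le Me]]] := unb n.
  by have [s [os sm Ms]] := gram_schmidt sM le Me; exists s; rewrite sm.
right; have D0 : exists n, `[<D n>].
  by exists 0%N; apply/asboolP; exists (fun=> 0); split=> [c _ []|[]].
have Dle n : `[<D n>] -> (n <= N)%N.
  move=> /asboolP Dn; rewrite leqNgt; apply/negP => Nn; apply: NP.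
  by exists n => //; exact: ltnW.
case: (ex_maxnP D0 Dle) => n /asboolP[e [le Me]] maxn.
have [s [os sn Ms]] := gram_schmidt sM le Me; exists s; split => //.
apply/eqP; rewrite eq_le orthonormal_dimension// andbT.
apply: ge_ereal_sup => _ [m Dm <-]; rewrite lee_fin ler_nat sn.
by apply: maxn; apply/asboolP.
Qed.

(** Pairs of an eigenvalue and an eigenvector, multiplicity being encoded by repetition. The
    eigenvalue 0 is left out: for p > 0 it adds nothing to the sums of p-th powers. *)
Definition eigen_system Q t := orthonormal_seq [seq z.2 | z <- t] /\
  forall z, z \in t -> 0 < z.1 /\ Q z.2 = z.1%:C *: z.2.

Lemma eigen_system_perm Q t t' : perm_eq t t' -> eigen_system Q t ->
  eigen_system Q t'.
Proof.
move=> tt' [[ut ot] et]; split; last by move=> z; rewrite -(perm_mem tt');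
  exact: et.
split; first by rewrite -(perm_uniq (perm_map _ tt')).
by move=> x y; rewrite -!(perm_mem (perm_map snd tt')); exact: ot.
Qed.

Lemma eigenvectors_orthogonal Q x y (a b : R) : psd Q -> a != b ->
  Q x = a%:C *: x -> Q y = b%:C *: y -> inner x y = 0.
Proof.
move=> pQ ab Qx Qy; have := psd_selfadjoint x y pQ.
rewrite Qx Qy innerZl innerZr conj_real => /eqP; rewrite -subr_eq0 -mulrBl.
by rewrite mulf_eq0 subr_eq0 => /orP[/eqP/complexI/eqP|/eqP//];
  rewrite (negPf ab).
Qed.

Lemma subspace_eigenspace Q (a : R) : bounded_op Q ->
  subspace (Defs.eigenspace Q a).
Proof.
move=> bQ; split; first by rewrite /Defs.eigenspace/= bounded_op0// scaler0.
move=> b x y Qx Qy; rewrite /Defs.eigenspace/= bQ.1 Qx Qy scalerDr !scalerA.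
by rewrite mulrC.
Qed.

(** * Eigenvalue sums under pointwise domination *)

Section comparison.
Variables (P T : H -> H) (p : R).
Hypothesis psdP : psd P.
Hypothesis bT : bounded_op T.
Hypothesis cT : clusters_on_ball T.
Hypothesis PT : forall x, hnorm (P x) <= hnorm (T x).
Hypothesis p0 : 0 < p.
Let Q := abs_op T.

(* Courant-Fischer: the span of the eigenvectors of P meets the orthogonal
   complement of fewer eigenvectors of Q, which provides the next one. *)
Lemma eigen_system_compare t : eigen_system P t ->
  sorted (fun a b => b.1 <= a.1) t ->
  exists t', [/\ eigen_system Q t', size t' = size t &
    \sum_(z <- t) z.1 `^ p <= \sum_(z <- t') z.1 `^ p].
Proof.
have [pQ QQ QT] : [/\ psd Q, forall x, Q (Q x) = adjoint T (T x) &
  forall x, hnorm (Q x) = hnorm (T x)] := abs_opP bT.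
(* The list is decreasing, so its last pair [z] has the smallest eigenvalue, and |P x| >= z.1 |x| on
   the whole span. *)
elim/last_ind: t => [|t z IH].
  by exists [::]; rewrite !big_nil.
move=> [[ut ot] et] st.
have zt : z \in rcons t z by rewrite mem_rcons inE eqxx.
have zmin a : a \in rcons t z -> z.1 <= a.1.
  rewrite mem_rcons inE => /predU1P[->//|].
  have tr : transitive (fun a b : R * H => b.1 <= a.1).
    by move=> b c d bc cd; exact: le_trans cd bc.
  move: st; rewrite -cats1 sorted_pairwise// pairwise_cat/= !andbT.
  by move=> /andP[/allrelP h _] /h; apply; rewrite inE.
have [||t' [[ot' et'] tt' tsum]] := IH.
- split; last by move=> a at_; apply: et; rewrite mem_rcons inE at_ orbT.
  split; first by move: ut; rewrite map_rcons rcons_uniq => /andP[].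
  by move=> x y xt yt; apply: ot; rewrite map_rcons mem_rcons inE ?xt ?yt orbT.
- by move: st; rewrite -cats1 => /cat_sorted2[].
pose s := [seq a.2 | a <- rcons t z]; pose s' := [seq a.2 | a <- t'].
pose e (i : 'I_(size s)) := nth 0 s i.
pose l (i : 'I_(size s)) := (nth z (rcons t z) i).1.
have size_s : size s = (size t).+1 by rewrite size_map size_rcons.
have oe i j : inner (e i) (e j) = (i == j)%:R by exact: orthonormal_nth.
have size_r : size s = size (rcons t z) by rewrite size_map.
have le_mem (i : 'I_(size s)) : nth z (rcons t z) i \in rcons t z.
  by apply: mem_nth; rewrite -size_r.
have el i : P (e i) = (l i)%:C *: e i.
  have -> : e i = (nth z (rcons t z) i).2 by rewrite /e (nth_map z) -?size_r.
  exact: (et _ (le_mem i)).2.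
have [|c [[i0 ci0] cs]] := @orthogonal_combination _ e s'.
  by rewrite size_s size_map tt'.
set x := \sum_i _ in cs.
have xE : hnorm x ^+ 2 = \sum_i cnorm (c i) ^+ 2 by exact:
  orthonormal_comb_norm.
have x0 : x != 0.
  apply/eqP => x0; have := orthonormal_comb_inner c i0 oe.
  by rewrite -/x x0 inner0l => /esym/eqP; rewrite (negPf ci0).
have Px : P x = \sum_i (c i * (l i)%:C) *: e i.
  rewrite (bounded_op_sum _ _ psdP.1); apply: eq_bigr => i _.
  by rewrite (bounded_opZ _ _ psdP.1) el scalerA.
have [z0 _] := et _ zt.
have zx : z.1 * hnorm x <= hnorm (T x).
  apply: le_trans (PT x); rewrite -ler_sqr ?nnegrE//; last first.
    by rewrite mulr_ge0// ltW.
  rewrite exprMn xE Px orthonormal_comb_norm// mulr_sumr ler_sum// => i _.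
  rewrite cnormM exprMn mulrC ler_wpM2l ?sqr_ge0// cnorm_real.
  have zl : z.1 <= l i by apply: zmin.
  by rewrite ler_sqr ?nnegrE ?(ltW z0)// (le_trans zl (ler_norm _)).
pose M := orthc [set` s'].
have QM y : M y -> M (Q y).
  move=> My f /mapP[a at_ ->]; have [a0 Qa] := et' _ at_.
  rewrite (psd_selfadjoint _ _ pQ) Qa innerZr My ?mulr0//.
  by apply/mapP; exists a.
have [|k [y [zk My y1 Qy]]] :=
    eigenvector_in_subspace bT cT (subspace_orthc _) (@hclosed_orthc _ _ _) QM _
      x0 z0 zx.
  by move=> f fs; exact: cs.
exists (rcons t' (k, y)); split.
- split; last first.
    move=> a; rewrite mem_rcons inE => /predU1P[->/=|/et'//].
    by split=> //; exact: lt_le_trans zk.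
  rewrite map_rcons -cats1; apply: orthonormal_cat => //.
    exact: orthonormal1.
  by move=> f g fs; rewrite inE => /eqP ->; apply: inner_eq0C; exact: My.
- by rewrite !size_rcons tt'.
- rewrite -!cats1 !big_cat/= !big_seq1 lerD//.
  have k0 : 0 < k by exact: lt_le_trans zk.
  by apply: (ge0_ler_powR (ltW p0)) => //=; rewrite nnegrE ltW.
Qed.

(** Group the list by eigenvalue: the vectors carrying the value l are orthonormal in its
    eigenspace, so their number is at most its dimension. *)
Lemma eigen_system_schatten t : eigen_system Q t ->
  ((\sum_(z <- t) z.1 `^ p)%:E <= schatten_sum p T)%E.
Proof.
move=> [[ut ot] et]; apply: esum_ge.
exists [set` undup [seq z.1 | z <- t]].
  split; first exact: finite_seq.
  move=> l /=; rewrite mem_undup => /mapP[z zt ->]; exists z.2.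
    apply/eqP => z0; have := ot z.2 z.2 (map_f _ zt) (map_f _ zt).
    by rewrite {1}z0 inner0l eqxx => /eqP; rewrite eq_sym oner_eq0.
  exact: (et z zt).2.
rewrite -fsbig_seq ?undup_uniq//.
rewrite -(big_map (fun z => z.1) xpredT (fun l => l `^ p)).
rewrite -big_undup_iterop_count/= -sumEFin; apply: lee_sum => l _.
set n := count_mem _ _.
have -> : iterop n +%R (l `^ p) 0 = n%:R * l `^ p.
  by rewrite mulr_natl.
rewrite EFinM lee_wpmul2r// ?lee_fin ?powR_ge0//.
pose tl := [seq z <- t | z.1 == l].
have -> : n = size [seq z.2 | z <- tl].
  by rewrite size_map size_filter /n count_map.
have tls : subseq [seq z.2 | z <- tl] [seq z.2 | z <- t].
  by apply: map_subseq; exact: filter_subseq.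
apply: orthonormal_dimension.
  split; first exact: subseq_uniq ut.
  by move=> x y xs ys; apply: ot; exact: mem_subseq tls _ _.
by move=> _ /mapP[z + ->]; rewrite mem_filter => /andP[/eqP <- /et[]].
Qed.

Lemma eigen_system_bound t : eigen_system P t ->
  ((\sum_(z <- t) z.1 `^ p)%:E <= schatten_sum p T)%E.
Proof.
move=> et; pose r := fun a b : R * H => b.1 <= a.1.
have rt : total r by move=> a b; exact: le_total.
have ps : perm_eq t (sort r t) by rewrite perm_sym perm_sort.
have [t' [et' _]] :=
  eigen_system_compare (eigen_system_perm ps et) (sort_sorted rt t).
rewrite -(perm_big _ ps)/= => h; apply: le_trans (eigen_system_schatten et').
by rewrite lee_fin.
Qed.

(** The list [t] accumulates eigenvectors: each eigenvalue of [s] in turn is replaced by an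
    orthonormal family of its eigenspace, orthogonal to [t] because its value does not occur
    there. *)
Lemma eigenvalues_schatten_bound (s : seq R) t : uniq s -> eigen_system P t ->
  (forall l, l \in s -> eigenvalues P l) ->
  (forall l, l \in s -> l \notin [seq z.1 | z <- t]) ->
  (\sum_(l <- s) dimension (Defs.eigenspace P l) * (l `^ p)%:E +
   (\sum_(z <- t) z.1 `^ p)%:E <= schatten_sum p T)%E.
Proof.
elim: s t => [|l s IH] t.
  by move=> _ et _ _; rewrite big_nil add0e; exact: eigen_system_bound.
move=> /= /andP[ls us] et es st; rewrite big_cons.
have es' m : m \in s -> eigenvalues P m by move=> ms; apply: es;
  rewrite inE ms orbT.
have st' m : m \in s -> m \notin [seq z.1 | z <- t].
  by move=> ms; apply: st; rewrite inE ms orbT.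
have [x x0 Px] : eigenvalues P l by apply: es; rewrite inE eqxx.
have l0 : 0 <= l.
  have := psdP.2 x; rewrite Px innerZl innerxx -rmorphM/= lecR.
  by rewrite pmulr_lge0// exprn_gt0// hnorm_gt0.
(* The kernel of [P] may be infinite-dimensional; its dimension is multiplied by the p-th power of
   0, that is 0. *)
have [le0|lpos] := eqVneq l 0.
  by rewrite [in l `^ p]le0 powR0 ?gt_eqF// mule0 add0e; exact: IH.
have {}l0 : 0 < l by rewrite lt_neqAle eq_sym lpos.
have step u : orthonormal_seq u ->
    (forall v, v \in u -> Defs.eigenspace P l v) ->
    ((size u)%:R%:E * (l `^ p)%:E +
     \sum_(m <- s) dimension (Defs.eigenspace P m) * (m `^ p)%:E +
     (\sum_(z <- t) z.1 `^ p)%:E <= schatten_sum p T)%E.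
  move=> ou eu; pose tu := [seq (l, v) | v <- u] ++ t.
  have etu : eigen_system P tu.
    split; last first.
      move=> z; rewrite mem_cat => /orP[/mapP[v vu ->]|/et.2//]; split => //.
      exact: eu.
    rewrite map_cat -map_comp map_id_in//; apply: orthonormal_cat => //.
      exact: et.1.
    move=> v w vu /mapP[z zt ->].
    apply: (eigenvectors_orthogonal (a := l) (b := z.1) psdP _ (eu _ vu)).
      apply/eqP => lz; have := st l; rewrite inE eqxx => /(_ erefl)/negP; apply.
      by apply/mapP; exists z.
    exact: (et.2 _ zt).2.
  have := IH tu us etu es'.
  rewrite big_cat/= big_map/= big_const_seq count_predT iter_addr addr0.
  rewrite -EFinM mulr_natl -addeA addeCA -EFinD; apply.
  move=> m ms; rewrite map_cat mem_cat negb_or st' ?andbT// -map_comp.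
  by apply/mapP => -[v _ /= ml]; move: ls; rewrite -ml ms.
have [unb|[u [ou eu ->]]] :=
  dimension_orthonormal (subspace_eigenspace l psdP.1); last exact: step.
(* An infinite-dimensional eigenspace with l > 0 provides eigen systems of [P] with sums n l^p for n
   as large as desired, all bounded by the right side. *)
suff -> : schatten_sum p T = +oo%E by exact: leey.
apply/eqyP => a a0.
have [u [ou nu eu]] := unb (Num.truncn (a / l `^ p)).+1.
apply: le_trans (_ : (\sum_(z <- [seq (l, v) | v <- u]) z.1 `^ p)%:E <= _)%E.
  rewrite big_map/= big_const_seq count_predT iter_addr addr0 lee_fin.
  rewrite -mulr_natl -ler_pdivrMr ?powR_gt0//.
  by apply: ltW; apply: lt_le_trans (truncnS_gt _) _; rewrite ler_nat.
apply: eigen_system_bound; split; first by rewrite -map_comp map_id_in.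
by move=> _ /mapP[v vu ->]; split => //; exact: eu.
Qed.

End comparison.

Lemma schatten_sum_le S T (p : R) : 0 < p -> bounded_op S -> bounded_op T ->
  clusters_on_ball T -> (forall x, hnorm (S x) <= hnorm (T x)) ->
  (schatten_sum p S <= schatten_sum p T)%E.
Proof.
move=> p0 bS bT cT ST; have [pP _ PS] := abs_opP bS.
apply: ge_ereal_sup => _ [X [fX XS] <-].
rewrite fsbig_finite//=.
have := @eigenvalues_schatten_bound (abs_op S) T p pP bT cT _ p0
  (finmap.enum_fset (fset_set X)) [::].
rewrite big_nil adde0; apply => //.
- by move=> x; rewrite PS.
- exact: finmap.fset_uniq.
- by move=> l lX; apply/XS/set_mem; rewrite -(in_fset_set fX).
Qed.

Lemma schatten_sum_ge0 T (p : R) : (0 <= schatten_sum p T)%E.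
Proof.
apply: esum_ge0 => l _; rewrite mule_ge0// ?lee_fin ?powR_ge0//.
by have := @orthonormal_dimension (Defs.eigenspace (abs_op T) l) [::]; apply.
Qed.

Lemma schatten_norm_le S T (p : R) : 0 < p -> bounded_op S -> bounded_op T ->
  clusters_on_ball T -> (forall x, hnorm (S x) <= hnorm (T x)) ->
  (schatten_norm p S <= schatten_norm p T)%E.
Proof.
move=> p0 bS bT cT ST; apply: gt0_ler_poweR.
- by rewrite invr_ge0 ltW.
- by rewrite in_itv/= schatten_sum_ge0 leey.
- by rewrite in_itv/= schatten_sum_ge0 leey.
- exact: schatten_sum_le.
Qed.

End schatten_monotone.

(** * Shorted operators *)

Section shorted_operator.
Context {R : realType} {H : hilbertType R}.
Implicit Types (x y z : H) (S T W Y : H -> H) (M : set H).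

(** Polarization: the norms determine the real parts of the inner products, and i y in place of y
    gives the imaginary parts. *)
Lemma isometric_inner S T x y : bounded_op S -> bounded_op T ->
  (forall z, hnorm (S z) = hnorm (T z)) ->
    inner (S x) (S y) = inner (T x) (T y).
Proof.
move=> bS bT ST;
  have re z : complex.Re (inner (S x) (S z)) = complex.Re (inner (T x) (T z)).
  have := hnormD_sqr (T x) (T z); have := hnormD_sqr (S x) (S z).
  by rewrite -!bounded_opD// !ST => ->; lra.
have im := re ('i%C *: y); apply/eqP; rewrite eq_complex re eqxx /=.
move: im; rewrite !bounded_opZ// !innerZr.
have -> : Num.conj 'i%C = - 'i%C :> R[i] by rewrite complexiE conjCi.
by rewrite !mulNr !raddfN/= ![_ * inner _ _]mulrC !ReiNIm !opprK => ->.
Qed.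

(** Equal norms give S^* S = T^* T, and the absolute value is selected by a property of this
    operator alone. *)
Lemma abs_op_isometric S T : bounded_op S -> bounded_op T ->
  (forall x, hnorm (S x) = hnorm (T x)) -> abs_op S = abs_op T.
Proof.
move=> bS bT ST; rewrite /abs_op; congr sqrt_op; apply/funext => x /=.
by apply: inner_ext => y; rewrite !inner_adjointl//; exact: isometric_inner.
Qed.

Definition shorted_formula W M : H -> H :=
  sqrt_op W \o proj (orthc (sqrt_op W @` M)) \o sqrt_op W.

Lemma inner_shorted_formula W M x : psd W ->
  inner (shorted_formula W M x) x =
  (hnorm (proj (orthc (sqrt_op W @` M)) (sqrt_op W x)) ^+ 2)%:C.
Proof.
move=> pW; have [pS SS] := sqrt_opP pW.
rewrite /shorted_formula/= (psd_selfadjoint _ _ pS) inner_proj ?innerxx//.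
  exact: subspace_orthc.
exact: hclosed_orthc.
Qed.

Lemma bounded_shorted_formula W M : psd W -> bounded_op (shorted_formula W M).
Proof.
move=> pW; have [[bS _] _] := sqrt_opP pW; apply: bounded_op_comp => //.
apply: bounded_op_comp => //; apply: bounded_op_proj.
  exact: subspace_orthc.
exact: hclosed_orthc.
Qed.

Lemma shortable_shorted_formula W M : psd W ->
  shortable W M (shorted_formula W M).
Proof.
move=> pW; have [pS SS] := sqrt_opP pW; have bF :=
  @bounded_shorted_formula W M pW.
have sN := subspace_orthc (sqrt_op W @` M).
have cN := @hclosed_orthc _ _ (sqrt_op W @` M).
split=> //.
- split; first exact: bounded_op_sub bounded_op_zero.
  by move=> x; rewrite /= subr0 inner_shorted_formula// lecR sqr_ge0.
- split; first exact: bounded_op_sub pW.1 bF.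
  move=> x; rewrite innerBl inner_shorted_formula//.
  rewrite -SS (psd_selfadjoint _ _ pS) innerxx -rmorphB/= lecR subr_ge0.
  by rewrite ler_sqr ?nnegrE// hnorm_proj.
- move=> _ [x _ <-] y My; rewrite /shorted_formula/= (psd_selfadjoint _ _ pS).
  by apply (projP (sqrt_op W x) sN cN).1; exists y.
Qed.

(* A shortable Y has the same quadratic form at x and at x - m for m in M, and
   <W (x - m), x - m> approaches the quadratic form of the formula at x. *)
Lemma shorted_formula_max W M Y : psd W -> subspace M -> shortable W M Y ->
  op_le Y (shorted_formula W M).
Proof.
move=> pW sM [bY pY YW YM]; have [pS SS] := sqrt_opP pW; have [bS _] := pS.
split; first exact: bounded_op_sub (bounded_shorted_formula M pW) bY.
move=> x; rewrite innerBl inner_shorted_formula//.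
have {}pY : psd Y by have := pY; rewrite /op_le; congr psd; apply/funext => z;
  rewrite /= subr0.
have -> : inner (Y x) x = (complex.Re (inner (Y x) x))%:C.
  by rewrite RRe_real// ger0_real// pY.2.
rewrite -rmorphB/= lecR subr_ge0.
pose SM := sqrt_op W @` M.
have sSM : subspace SM.
  split; first by exists 0; [exact: sM.1 | rewrite bounded_op0].
  move=> a _ _ [y My <-] [z Mz <-]; exists (a *: y + z); first exact: sM.2.
  by rewrite bS.1.
have [Cc rC] :=
  projP (sqrt_op W x) (subspace_hclosure sSM) (@hclosed_hclosure _ _ SM).
set c := proj _ _ in Cc rC.
(* With c in the closure of S M, the projection is approximated by vectors S (x - m), on which Y and
   W can be compared. *)
have -> : proj (orthc SM) (sqrt_op W x) = sqrt_op W x - c.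
  apply: proj_unique.
  - exact: subspace_orthc.
  - exact: hclosed_orthc.
  - by move=> y SMy; apply: rC; exact: sub_hclosure.
  - rewrite opprB addrC subrK => y Ny; apply: inner_small => e /Cc[z SMz cz].
    by exists z => //; apply: inner_eq0C; exact: Ny.
set r := hnorm (sqrt_op W x - c).
suff h (e : R) : 0 < e -> complex.Re (inner (Y x) x) <= (r + e) ^+ 2.
  have r0 : 0 <= r by exact: hnorm_ge0.
  apply/ler_addgt0Pr => d d0.
  have k0 : 0 < 2 * r + 1 by lra.
  (* Since e <= 1, (r + e)^2 <= r^2 + e (2 r + 1). *)
  pose e := Num.min 1 (d / (2 * r + 1)).
  have e0 : 0 < e by rewrite lt_min ltr01 divr_gt0.
  have e1 : e <= 1 by rewrite ge_min lexx.
  have ed : e * (2 * r + 1) <= d by rewrite -ler_pdivlMr// ge_min lexx orbT.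
  by apply: le_trans (h e e0) _; nra.
move=> e0; have [_ [m Mm <-] cm] := Cc _ e0.
have Ym z : inner (Y z) m = 0 by apply: YM => //; exists z.
have -> : inner (Y x) x = inner (Y (x - m)) (x - m).
  rewrite innerBr Ym subr0 bounded_opB// innerBl.
  by rewrite (psd_selfadjoint m _ pY) (inner_eq0C (Ym x)) subr0.
apply: (@le_trans _ _ (hnorm (sqrt_op W (x - m)) ^+ 2)).
  rewrite hnorm_sqrt_op//; have := YW.2 (x - m); rewrite /= innerBl lecE.
  by move=> /andP[_]; rewrite raddfB/= subr_ge0.
rewrite ler_sqr ?nnegrE//; last by apply: addr_ge0 (ltW e0); exact: hnorm_ge0.
rewrite bounded_opB//; apply: le_trans (hdist_tri c _ _) _.
by rewrite lerD2l ltW.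
Qed.

(** The formula provides the maximum that the choice asks for; conversely the chosen maximum and the
    formula dominate each other, so their quadratic forms agree, and these determine the norms after
    the square root. *)
Lemma shorted_psd W M : psd W -> subspace M -> psd (shorted W M) /\
  forall x, inner (shorted W M x) x = inner (shorted_formula W M x) x.
Proof.
move=> pW sM; rewrite /shorted; case: xgetP => [X _ [[bX pX XW XM] Xmax]|nX].
  have pX' : psd X.
    by have := pX; rewrite /op_le; congr psd; apply/funext => z;
      rewrite /= subr0.
  split=> // x; apply/eqP; rewrite eq_le.
  have FX := Xmax _ (shortable_shorted_formula M pW).
  have XF : op_le X (shorted_formula W M) by exact: shorted_formula_max.
  have := FX.2 x; have := XF.2 x.
  by rewrite !innerBl !subr_ge0 => -> ->.
case: (nX (shorted_formula W M)); split; first exact: shortable_shorted_formula.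
by move=> Y; exact: shorted_formula_max.
Qed.

(** S v is orthogonal to S M, so projecting S (a + v) on the orthogonal complement of S M leaves S
    v. *)
Lemma hnorm_sqrt_shorted W M a v : psd W -> subspace M -> M a ->
  weighted_orthc W M v ->
  hnorm (sqrt_op (shorted W M) (a + v)) = hnorm (sqrt_op W v).
Proof.
move=> pW sM Ma vM; have [pS SS] := sqrt_opP pW; have [bS _] := pS.
have [pF FE] := shorted_psd pW sM.
apply/eqP; rewrite -(@eqrXn2 _ 2)//; apply/eqP.
rewrite hnorm_sqrt_op// FE inner_shorted_formula//=.
congr (hnorm _ ^+ 2); rewrite bounded_opD//; apply: proj_unique.
- exact: subspace_orthc.
- exact: hclosed_orthc.
- by move=> _ [m Mm <-]; rewrite -(psd_selfadjoint _ _ pS) SS; exact: vM.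
- by rewrite addrK => y Ny; apply: inner_eq0C; apply: Ny; exists a.
Qed.

End shorted_operator.

(** * The minimizer and the value of the minimum *)

Theorem proposition4p1 (R : realType) (H : hilbertType R) (A B C W : H -> H)
    (p : R) (sepH : separable H)
    (bA : bounded_op A) (bB : bounded_op B) (bC : bounded_op C)
    (cA : closed (range A)) (cB : closed (range B))
    (psdW : psd W) (p1 : 1 <= p) (SpW : schatten_class p (sqrt_op W))
    (NB : nullspace B `<=` nullspace (adjoint A \o W \o C))
    (RC : range C `<=`
          [set x + y | x in range A & y in weighted_orthc W (range A)]) :
  exists X0 : H -> H,
    [/\ bounded_op X0,
        forall X : H -> H, bounded_op X ->
          (weighted_norm p W ((A \o X0 \o B) \- C)%R <=
           weighted_norm p W ((A \o X \o B) \- C)%R)%E &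
        weighted_norm p W ((A \o X0 \o B) \- C)%R =
        schatten_norm p (sqrt_op (shorted W (range A)) \o C)].
Proof.
have p0 : 0 < p by exact: lt_le_trans p1.
have [pS SS] := sqrt_opP psdW; have [bS _] := pS.
set S := sqrt_op W in pS SS bS SpW *.
pose G := S \o A; have bG : bounded_op G by exact: bounded_op_comp.
have sA := subspace_range bA.
pose Gc := hclosure (range G).
have sGc : subspace Gc by exact/subspace_hclosure/subspace_range.
have cGc : hclosed Gc by exact: hclosed_hclosure.
pose K := proj Gc \o S \o C.
have bK : bounded_op K.
  by apply: bounded_op_comp => //; apply: bounded_op_comp => //;
    exact: bounded_op_proj.
have GS u v : weighted_orthc W (range A) v -> inner (G u) (S v) = 0.
  move=> Av;
    rewrite /G/= -(psd_selfadjoint _ _ pS) SS (psd_selfadjoint _ _ psdW).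
  by apply: inner_eq0C; apply: Av; exists u.
(* The remainder S C x - G u = S v is orthogonal to R(G), so G u is the projection [K x], whichever
   u is taken. *)
have decC x : exists u v,
    [/\ C x = A u + v, weighted_orthc W (range A) v & K x = G u].
  have [_ [u _ <-] [v Av uv]] := RC (C x) (ex_intro2 _ _ x I erefl).
  exists u, v; split=> //; rewrite /K/= -uv bounded_opD//;
    apply: proj_unique => //.
    by apply: sub_hclosure; exists u.
  rewrite addrAC subrr add0r => y yG; apply: inner_eq0C.
  apply: inner_small => e /yG[z [w _ <-] yz].
  by exists (G w) => //; exact: GS.
have [X1 [bX1 GX1 X1G]] : exists X, [/\ bounded_op X, forall x, G (X x) = K x &
    forall x, orthc (nullspace G) (X x)].
  apply: douglas => // _ [x _ <-]; have [u [v [_ _ ->]]] := decC x.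
  by exists u.
have X1B x : B x = 0 -> X1 x = 0.
  move=> Bx; have [u [v [Cx Av Kx]]] := decC x.
  have Gu : G u = 0.
    apply: innerxx_eq0.
    have -> : inner (G u) (G u) = inner (W (C x)) (A u).
      rewrite Cx (bounded_opD (A u) v psdW.1) innerDl (Av (A u))//.
      by rewrite addr0 -SS (psd_selfadjoint _ _ pS).
    have := NB _ Bx; rewrite /nullspace/= => h.
    by rewrite innerC (adjointP bA).2 h inner0r rmorph0.
  by apply/innerxx_eq0/X1G; rewrite /nullspace/= GX1 Kx.
have sB := subspace_range bB.
have hcB : hclosed (range B) by move=> x xB; exact: closed_hnorm.
(* Douglas' lemma again, for [B] and the projection on its closed range, provides the bounded right
   inverse. *)
have [B' [bB' BB' _]] : exists X, [/\ bounded_op X,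
    forall x, B (X x) = proj (range B) x & forall x, orthc (nullspace B) (X x)].
  apply: douglas => //; first exact: bounded_op_proj.
  by move=> _ [x _ <-]; exact: (projP x sB hcB).1.
pose X0 := X1 \o B'; have bX0 : bounded_op X0 by exact: bounded_op_comp.
(* B' (B x) - x lies in N(B), where [X1] vanishes. *)
have X0B x : X0 (B x) = X1 x.
  apply/subr0_eq; rewrite /X0/= -bounded_opB//; apply: X1B.
  by rewrite bounded_opB// BB' proj_id ?subrr//; exists x.
pose D := (A \o X0 \o B) \- C.
have bD X : bounded_op X -> bounded_op ((A \o X \o B) \- C).
  by move=> bX; apply: bounded_op_sub => //; do 2 apply: bounded_op_comp => //.
have SD x : exists v, [/\ weighted_orthc W (range A) v, S (D x) = - S v &
    hnorm (S v) = hnorm (sqrt_op (shorted W (range A)) (C x))].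
  have [u [v [Cx Av Kx]]] := decC x; exists v; split=> //.
    rewrite /D/= bounded_opB// X0B -[S (A _)]/(G _) GX1 Kx Cx bounded_opD//.
    by rewrite opprD addrA subrr add0r.
  by rewrite Cx hnorm_sqrt_shorted//; exists u.
exists X0; split=> //.
- move=> X bX; apply: schatten_norm_le => //.
  + by apply: bounded_op_comp => //; exact: bD.
  + by apply: bounded_op_comp => //; exact: bD.
  (* Compactness of [S] passes to S (A X B - C) in the form of clustering. *)
  + apply: clusters_on_ball_comp => //; last exact: bD.
    by move=> u u1; apply: compact_op_cluster u1; case: SpW.
  + move=> x /=; rewrite -/(D x); have [v [Av SDx _]] := SD x.
    have -> : A (X (B x)) - C x = A (X (B x) - X0 (B x)) + D x.
      by rewrite bounded_opB// /D/= addrA subrK.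
    rewrite [X in _ <= hnorm X]bounded_opD// -ler_sqr ?nnegrE// pythagoras.
      by rewrite lerDr sqr_ge0.
    by rewrite -/S SDx innerNr -[S (A _)]/(G _) GS ?oppr0.
- have [pF _] := shorted_psd psdW sA; have [[bF _] _] := sqrt_opP pF.
  rewrite /weighted_norm /schatten_norm /schatten_sum.
  (* Equal norms at every vector give the same absolute value, hence the same Schatten sum. *)
  rewrite (@abs_op_isometric _ _ (S \o D) (sqrt_op (shorted W (range A)) \o
    C))//.
  + by apply: bounded_op_comp => //; exact: bD.
  + exact: bounded_op_comp.
  + by move=> x /=; have [v [_ -> <-]] := SD x; rewrite hnormN.
Qed.
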